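(* Consider the model $y_t=x_t'\beta_{T,t}+\varepsilon_t$ with $\beta_{T,t}=T^{-1/2}\sum_{i=1}^tu_i$ and the estimator $\hat\beta_t=\big(\sum_{i=t-Th}^{t+Th}x_ix_i'\big)^{-1}\sum_{i=t-Th}^{t+Th}x_iy_i$, where $h=h_T\to0$, $Th\to\infty$ as $T\to\infty$ and $Th$ is an integer. Under conditions (a)–(d) of the context, the mean squared error $\mathrm{MSE}(h)=E\|\hat\beta_t-\beta_{T,t}\|^2$ satisfies, as $T\to\infty$, $$\mathrm{MSE}(h)=\frac{\sigma_u^2h}{4}\,\mathrm{tr}\big[\Omega^{-1}(\Lambda\bar\Lambda+\bar\Lambda\Lambda-2\Xi)\Omega^{-1}\big](1+o(1))+\frac{\sigma_\varepsilon^2}{2Th}\,\mathrm{tr}[\Omega^{-1}](1+o(1)).$$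
   Context: Here $x_t$ and $u_t=(u_{t,1},\dots,u_{t,p})'$ are $p$-dimensional, $\varepsilon_t$ is scalar, $t$ is an interior time point (so that $1\le t-Th$ and $t+Th\le T$), and $\|v\|=(v'v)^{1/2}$. For matrices, $A>0$ means positive definite. Conditions: (a) $\{x_t\}_t$ is a $p$-dimensional stationary sequence with $E[x_1x_1']>0$. (b) $\{(\varepsilon_t,u_t')\}_t$ is a $(p+1)$-dimensional i.i.d. sequence, independent of $\{x_t\}_t$, with mean zero and variance $\mathrm{diag}(\sigma_\varepsilon^2,\sigma_u^2I_p)$. Moreover $\varepsilon_t$ and $u_t$ are independent. (c) There exist nonrandom matrices $\Omega>0$, $\Lambda$, $\bar\Lambda$, $\Xi$ with $\Lambda\bar\Lambda+\bar\Lambda\Lambda-2\Xi>0$ such that, as $T\to\infty$, $(2Th)^{-1}\sum_{i=t-Th}^{t+Th}x_ix_i'\stackrel{p}{\to}\Omega$, $(Th)^{-1}\sum_{i=t-Th}^{t-1}x_ix_i'\stackrel{p}{\to}\Lambda$, $(Th)^{-1}\sum_{i=1}^{Th}\frac{i}{Th}x_{t-i}x_{t-i}'\stackrel{p}{\to}\bar\Lambda$, and $(Th)^{-1}\sum_{i=t-Th}^{t-1}x_ix_i'\,(Th)^{-1}\sum_{j=t-Th}^{i}\frac{i-j}{Th}x_jx_j'\stackrel{p}{\to}\Xi$ (in the last expression the $j$-sum is inside the $i$-sum). (d) The matrices $\{(2Th)^{-1}\sum_{i=t-Th}^{t+Th}x_ix_i'\}^{-1}$, $(Th)^{-1}\sum_{i=t-Th}^{t-1}x_ix_i'$,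 $(Th)^{-1}\sum_{i=1}^{Th}\frac{i}{Th}x_{t-i}x_{t-i}'$, $(Th)^{-1}\sum_{i=t-Th}^{t-1}x_ix_i'\,(Th)^{-1}\sum_{j=t-Th}^{i}\frac{i-j}{Th}x_jx_j'$, and their products, are all uniformly integrable (in $T$). *)

(* Defs.v *)
From HB Require Import structures.
From mathcomp Require Import all_boot all_order all_algebra.
From mathcomp Require Import all_classical all_reals all_analysis.

Set Implicit Arguments.
Unset Strict Implicit.
Unset Printing Implicit Defensive.

Import Order.TTheory GRing.Theory Num.Theory.
Import numFieldNormedType.Exports.

Local Open Scope classical_set_scope.
Local Open Scope ring_scope.

Section Matrices.
Context {R : realType} {p : nat}.

Definition posdef (A : 'M[R]_p) : Prop :=
  A^T = A /\ forall v : 'cV[R]_p, v != 0 -> 0 < (v^T *m A *m v) 0 0.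

(* The Euclidean norm; the library's norm on matrices is the maximum norm. *)
Definition enorm (v : 'cV[R]_p) : R := Num.sqrt ((v^T *m v) 0 0).

End Matrices.

(* Families of real random variables over an arbitrary index type I, seen as
   random elements of R^I: a random p-vector has I = 'I_p, a vector process
   has I = nat * 'I_p. *)
Section RandomElements.
Context {d : measure_display} {W : measurableType d} {R : realType}.
Variable P : probability W R.

(* The product sigma-algebra of R^I, generated by the coordinate maps; for
   finite I it is the Borel sigma-algebra. *)
Definition product_sigma (I : Type) : set_system (I -> R) :=
  <<s [set A | exists i : I, exists2 B : set R,
         measurable B & A = [set f | B (f i)]] >>.

Definition event (I : Type) (X : I -> W -> R) (A : set (I -> R)) : set W :=
  [set w | A (X ^~ w)].

Definition same_law (I : Type) (X Y : I -> W -> R) : Prop :=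
  forall A, product_sigma A -> P (event X A) = P (event Y A).

Definition independent (I J : Type) (X : I -> W -> R) (Y : J -> W -> R)
    : Prop :=
  forall A B, product_sigma A -> product_sigma B ->
    P (event X A `&` event Y B) = (P (event X A) * P (event Y B))%E.

Definition mutually_independent (I : Type) (X : nat -> I -> W -> R) : Prop :=
  forall (J : seq nat) (A : nat -> set (I -> R)),
    uniq J -> (forall k, product_sigma (A k)) ->
    P (\bigcap_(k in [set` J]) event (X k) (A k)) =
    (\prod_(k <- J) P (event (X k) (A k)))%E.

Definition process (I : Type) (X : nat -> I -> W -> R) : nat * I -> W -> R :=
  fun ki => X ki.1 ki.2.

Definition strictly_stationary (I : Type) (X : nat -> I -> W -> R) : Prop :=
  forall s : nat, same_law (process X) (process (fun k => X (k + s)%N)).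

Definition iid (I : Type) (X : nat -> I -> W -> R) : Prop :=
  mutually_independent X /\ forall k : nat, same_law (X 0%N) (X k).

Definition cvg_in_probability (X : nat -> W -> R) (l : R) : Prop :=
  forall e : R, 0 < e ->
    P [set w | e < `|X T w - l|] @[T --> \oo] --> 0%E.

Definition mx_cvg_in_probability (p : nat) (M : nat -> W -> 'M[R]_p)
    (L : 'M[R]_p) : Prop :=
  forall i j, cvg_in_probability (fun T w => M T w i j) (L i j).

Definition uniformly_integrable (D : set nat) (X : nat -> W -> R) : Prop :=
  (forall T, D T -> measurable_fun setT (X T)) /\
  ereal_sup [set (\int[P]_(w in [set w | (K < `|X T w|)%R]) `|X T w|%:E)%E
            | T in D] @[K --> +oo%R] --> 0%E.

(* Uniform integrability as T -> oo, that is from some T0 on: for small T the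
   window t - Th .. t + Th need not lie in the sample, nor be long enough for
   the inverse second moment matrix to be integrable. *)
Definition mx_uniformly_integrable (p : nat) (M : nat -> W -> 'M[R]_p)
    : Prop :=
  exists T0 : nat, forall i j,
    uniformly_integrable [set T | (T0 <= T)%N] (fun T w => M T w i j).

End RandomElements.

(* Time starts at 1: x 0, u 0 and eps 0 play no role. Sequences indexed from 0
   are obtained by the shift k |-> k.+1. *)
Section Model.
Context {d : measure_display} {W : measurableType d} {R : realType}.
Variables (P : probability W R) (p : nat).
Variables (x u : nat -> 'I_p -> {RV P >-> R}) (eps : nat -> {RV P >-> R}).

Definition vec (v : nat -> 'I_p -> {RV P >-> R}) (t : nat) (w : W)
    : 'cV[R]_p := \col_i v t i w.

Definition xx (i : nat) (w : W) : 'M[R]_p := vec x i w *m (vec x i w)^T.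

Definition beta (T t : nat) (w : W) : 'cV[R]_p :=
  (Num.sqrt T%:R)^-1 *: \sum_(1 <= i < t.+1) vec u i w.

Definition y (T t : nat) (w : W) : R :=
  ((vec x t w)^T *m beta T t w) 0 0 + eps t w.

(* Below n is the half-width Th of the window, a natural number, and
   t - n is only used when n < t. *)

Definition window_sum (n t : nat) (w : W) : 'M[R]_p :=
  \sum_(t - n <= i < (t + n).+1) xx i w.

Definition beta_hat (T n t : nat) (w : W) : 'cV[R]_p :=
  invmx (window_sum n t w) *m
  \sum_(t - n <= i < (t + n).+1) y T i w *: vec x i w.

Definition MSE (T n t : nat) : \bar R :=
  'E_P[fun w => (enorm (beta_hat T n t w - beta T t w) ^+ 2)%R]%E.

Definition Omega_hat (n t : nat) (w : W) : 'M[R]_p :=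
  (2 * n%:R)^-1 *: window_sum n t w.

Definition Lambda_hat (n t : nat) (w : W) : 'M[R]_p :=
  n%:R^-1 *: \sum_(t - n <= i < t) xx i w.

Definition Lambda_bar_hat (n t : nat) (w : W) : 'M[R]_p :=
  n%:R^-1 *: \sum_(1 <= i < n.+1) (i%:R / n%:R) *: xx (t - i)%N w.

Definition Xi_hat (n t : nat) (w : W) : 'M[R]_p :=
  n%:R^-1 *: \sum_(t - n <= i < t)
    (xx i w *m (n%:R^-1 *: \sum_(t - n <= j < i.+1)
                  ((i - j)%:R / n%:R) *: xx j w)).

Definition cond_a : Prop :=
  [/\ strictly_stationary P (fun k i => x k.+1 i : W -> R),
      forall i, (x 1%N i : W -> R) \in Lfun P 2%:E &
      posdef (\matrix_(i, j) fine 'E_P[fun w => (x 1%N i w * x 1%N j w)%R]%E)].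

(* The (p+1)-dimensional vector (eps_t, u_t')', with None indexing eps_t. *)
Definition eps_u (t : nat) (o : option 'I_p) : W -> R :=
  if o is Some i then u t i else eps t.

Definition cond_b (sigma_eps sigma_u : R) : Prop :=
  [/\ iid P (fun k => eps_u k.+1),
      independent P (process (fun k => eps_u k.+1))
                    (process (fun k i => x k.+1 i : W -> R)),
      (forall t o, (1 <= t)%N ->
         eps_u t o \in Lfun P 2%:E /\ 'E_P[eps_u t o]%E = 0%E),
      (forall t, (1 <= t)%N ->
         [/\ covariance P (eps t) (eps t) = (sigma_eps ^+ 2)%:E,
             (forall i, covariance P (eps t) (u t i) = 0%E) &
             forall i j, covariance P (u t i) (u t j) =
                         (if i == j then sigma_u ^+ 2 else 0)%:E]) &
      forall t, (1 <= t)%N ->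
        independent P (fun _ : unit => eps t : W -> R)
                      (fun i => u t i : W -> R)].

Definition cond_c (n t : nat -> nat) (Omega Lambda Lambda_bar Xi : 'M[R]_p)
    : Prop :=
  [/\ posdef Omega,
      posdef (Lambda *m Lambda_bar + Lambda_bar *m Lambda - 2 *: Xi),
      mx_cvg_in_probability P (fun T => Omega_hat (n T) (t T)) Omega,
      mx_cvg_in_probability P (fun T => Lambda_hat (n T) (t T)) Lambda &
      mx_cvg_in_probability P (fun T => Lambda_bar_hat (n T) (t T))
        Lambda_bar /\
      mx_cvg_in_probability P (fun T => Xi_hat (n T) (t T)) Xi].

Definition factors (n t : nat) (w : W) : 4.-tuple 'M[R]_p :=
  [tuple invmx (Omega_hat n t w); Lambda_hat n t w; Lambda_bar_hat n t w;
         Xi_hat n t w].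

Definition factor_product (s : seq 'I_4) (n t : nat) (w : W) : 'M[R]_p :=
  \big[mulmx/1%:M]_(k <- s) tnth (factors n t w) k.

(* The inverse of the window matrix is presupposed to exist; since invmx is
   total (it returns a singular matrix unchanged), this has to be said. The
   products are all finite ones, in any order and with repetitions; the
   one-letter words s give the four matrices themselves. *)
Definition cond_d (n t : nat -> nat) : Prop :=
  (\forall T \near \oo,
     {ae P, forall w, window_sum (n T) (t T) w \in unitmx}) /\
  forall s : seq 'I_4,
    mx_uniformly_integrable P (fun T => factor_product s (n T) (t T)).

End Model.

(* Main.v *)
(** The error is linear in the noise,
      beta_hat - beta_t = S^-1 (sum_k T^(-1/2) C_k u_k + sum_k eps_k x_k),
    where S is the window sum,
    C_k = - (x_(t-n) x_(t-n)' + ... + x_(k-1) x_(k-1)') for k <= t and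
    C_k = x_k x_k' + ... + x_(t+n) x_(t+n)' for k > t.
    Independence of the regressors and the noise gives
      MSE = E [ sigma_u^2 / T tr (S^-1 (sum_k C_k^2) S^-1)
                + sigma_eps^2 tr (S^-1) ].
    By Abel summation the part k <= t of n^-3 sum_k C_k^2 is exactly
    Lambda_hat Lambda_bar_hat - Xi_hat, hence tends to
    G = Lambda Lambda_bar - Xi. The part k > t is a functional of the window to
    the right of t, which by stationarity has the law of the same functional of
    the window to the left of t; the latter equals
    (1 + 1/n) Lambda_hat^2 - Lambda_hat Lambda_bar_hat
    - Lambda_bar_hat Lambda_hat + (Lambda_hat Lambda_bar_hat - Xi_hat).
    Convergence of Lambda_hat along n_T and stationarity force
    Lambda_bar = Lambda / 2, so that this part tends to G as well, and 2 G is
    the matrix in the statement.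
    The limits pass through expectations because all moments of all the factors
    are bounded: the entries of a symmetric matrix A satisfy
    A_ij^2 <= tr (A^2), so that the uniform integrability of all powers of
    Lambda_hat and of the inverse of Omega_hat bounds all their moments, while
    the remaining matrices are dominated by traces of Lambda_hat, taken on
    windows of the same law. *)

Require Import Defs.
From HB Require Import structures.
From mathcomp Require Import all_boot all_order all_algebra.
From mathcomp Require Import all_classical all_reals all_analysis.
From mathcomp Require Import measurable_realfun ring lra zify.

Set Implicit Arguments.
Unset Strict Implicit.
Unset Printing Implicit Defensive.

Import Order.TTheory GRing.Theory Num.Theory.
Import numFieldNormedType.Exports.

Local Open Scope classical_set_scope.
Local Open Scope ring_scope.

(** * Elementary inequalities between powers *)

Section PowerInequalities.
Context {R : realFieldType}.
Implicit Types a b e : R.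

Lemma normr_expD_le a b k :
  `|a + b| ^+ k <= 2 ^+ k * `|a| ^+ k + 2 ^+ k * `|b| ^+ k.
Proof.
have H c : `|a + b| <= 2 * c -> `|a + b| ^+ k <= 2 ^+ k * c ^+ k.
  by rewrite -exprMn => h; rewrite lerXn2r// nnegrE (le_trans _ h).
have p2 c : 0 <= 2 ^+ k * `|c| ^+ k by rewrite mulr_ge0 ?exprn_ge0.
have [ab|ba] := leP `|a| `|b|.
  rewrite ler_wpDl//; apply: H; apply: (le_trans (ler_normD _ _)); lra.
rewrite ler_wpDr//; apply: H; apply: (le_trans (ler_normD _ _)); lra.
Qed.

Lemma normr_exp_le1D a k l : (k <= l)%N -> `|a| ^+ k <= `|a| ^+ l + 1.
Proof.
move=> kl; have [a1|a1] := leP `|a| 1.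
  by rewrite ler_wpDl ?exprn_ge0 ?exprn_ile1.
by rewrite ler_wpDr// ler_eXn2l.
Qed.

(** Young's inequality with a free weight: right side minus left side is a multiple of a square. A
    small [e] makes the contribution of [b] negligible, and the large [(4 * e)^-1] falls on [a]. *)
Lemma normr_expM_le a b k e : 0 < e ->
  `|a * b| ^+ k <= (4 * e)^-1 * `|a| ^+ (2 * k) + e * `|b| ^+ (2 * k).
Proof.
move=> e0; rewrite normrM exprMn !(mulnC 2) !exprM.
set x := _ ^+ k; set z := _ ^+ k.
rewrite -subr_ge0.
rewrite (_ : _ - _ = (4 * e)^-1 * (x - 2 * e * z) ^+ 2).
  by rewrite mulr_ge0 ?sqr_ge0// invr_ge0; lra.
by field; rewrite gt_eqF.
Qed.

End PowerInequalities.

(** * Absolute moments of all orders: boundedness and vanishing *)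

Section Moments.
Context {d : measure_display} {W : measurableType d} {R : realType}.
Variable P : probability W R.

Lemma ge0_integral_le_lin (F G H : W -> R) (a b : R) :
  measurable_fun setT F -> measurable_fun setT G -> measurable_fun setT H ->
  0 <= a -> 0 <= b ->
  (forall w, 0 <= F w) -> (forall w, 0 <= G w) -> (forall w, 0 <= H w) ->
  (forall w, F w <= a * G w + b * H w) ->
  (\int[P]_w (F w)%:E <=
   a%:E * \int[P]_w (G w)%:E + b%:E * \int[P]_w (H w)%:E)%E.
Proof.
move=> mF mG mH a0 b0 F0 G0 H0 le.
have mE (f : W -> R) : measurable_fun setT f ->
  measurable_fun setT (EFin \o f) by move/measurable_EFinP.
rewrite -!ge0_integralZl_EFin//; [|by move=> *; rewrite lee_fin|exact: mE..
  |by move=> *; rewrite lee_fin|exact: mE].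
rewrite -ge0_integralD//; last first.
- by apply: mE; apply: measurable_funM.
- by move=> *; rewrite lee_fin mulr_ge0.
- by apply: mE; apply: measurable_funM.
- by move=> *; rewrite lee_fin mulr_ge0.
apply: ge0_le_integral => //.
- by move=> *; rewrite lee_fin.
- exact: mE.
- by apply: emeasurable_funD; apply: mE; apply: measurable_funM.
- by move=> w _; rewrite -!EFinM -EFinD lee_fin.
Qed.

Definition moment (k : nat) (f : W -> R) : \bar R :=
  (\int[P]_w (`|f w| ^+ k)%:E)%E.

Lemma moment_ge0 k f : (0 <= moment k f)%E.
Proof. by apply: integral_ge0 => w _; rewrite lee_fin exprn_ge0. Qed.

Lemma measurable_normX (f : W -> R) k : measurable_fun setT f ->
  measurable_fun setT (fun w => `|f w| ^+ k).
Proof. by move=> mf; apply: measurable_funX; exact: measurableT_comp. Qed.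

Lemma moment_le_lin (f g h : W -> R) i j k (a b : R) :
  measurable_fun setT f -> measurable_fun setT g -> measurable_fun setT h ->
  0 <= a -> 0 <= b ->
  (forall w, `|f w| ^+ k <= a * `|g w| ^+ i + b * `|h w| ^+ j) ->
  (moment k f <= a%:E * moment i g + b%:E * moment j h)%E.
Proof.
by move=> mf mg mh a0 b0 le; apply: ge0_integral_le_lin => //;
  (exact: measurable_normX || by move=> w; rewrite exprn_ge0).
Qed.

Lemma moment_cst k (c : R) : moment k (cst c) = (`|c| ^+ k)%:E.
Proof.
rewrite /moment (_ : (fun w => _) = cst (`|c| ^+ k)%:E)//.
rewrite integral_cst// [X in (_ * X)%E](_ : _ = 1%E) ?mule1//.
exact: probability_setT.
Qed.

Implicit Types X Y : nat -> W -> R.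

(** Only for large T, because the hypotheses on windows and uniform integrability hold only from
    some T on. *)
Definition moment_bounded k X :=
  exists C : R, \forall T \near \oo, (moment k (X T) <= C%:E)%E.

Definition moments_bounded X :=
  (forall T, measurable_fun setT (X T)) /\ forall k, moment_bounded k X.

(** Convergence to zero in L^q for every integer q >= 1; order zero is excluded, that moment being
    always 1. *)
Definition moments_vanish X :=
  (forall T, measurable_fun setT (X T)) /\
  forall k (e : R), 0 < e -> \forall T \near \oo, (moment k.+1 (X T) <= e%:E)%E.

Lemma moment_boundedP k X : moment_bounded k X ->
  exists2 C : R, 0 <= C & \forall T \near \oo, (moment k (X T) <= C%:E)%E.
Proof.
move=> [C hC]; exists `|C| => //; near=> T; apply: (@le_trans _ _ C%:E).
  by near: T.
by rewrite lee_fin ler_norm.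
Unshelve. all: by end_near. Qed.

Lemma moment_bounded_lin (i j k : nat) X Y (Z : nat -> W -> R) (a b : R) :
  (forall T, measurable_fun setT (X T)) ->
  (forall T, measurable_fun setT (Y T)) ->
  (forall T, measurable_fun setT (Z T)) -> 0 <= a -> 0 <= b ->
  (\forall T \near \oo, forall w,
    `|X T w| ^+ k <= a * `|Y T w| ^+ i + b * `|Z T w| ^+ j) ->
  moment_bounded i Y -> moment_bounded j Z -> moment_bounded k X.
Proof.
move=> mX mY mZ a0 b0 le [C hC] [D hD]; exists (a * C + b * D); near=> T.
apply: (le_trans (@moment_le_lin _ (Y T) (Z T) i j k a b _ _ _ _ _ _)) => //.
  by near: T.
rewrite EFinD !EFinM; apply: leeD; apply: lee_wpmul2l; rewrite ?lee_fin//.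
  by near: T.
by near: T.
Unshelve. all: by end_near. Qed.

Lemma moment_bounded_cst k (c : R) : moment_bounded k (fun _ _ => c).
Proof.
by exists (`|c| ^+ k); near=> T; rewrite -moment_cst.
Unshelve. all: by end_near. Qed.

Lemma moments_bounded_dominated X Y :
  (forall T, measurable_fun setT (X T)) -> moments_bounded Y ->
  (\forall T \near \oo, forall w, `|X T w| <= `|Y T w|) -> moments_bounded X.
Proof.
move=> mX [mY bY] le; split => // k.
apply: (@moment_bounded_lin k 0 k X Y (fun _ _ => 0) 1 0) => //.
  near=> T => w; rewrite mul0r addr0 mul1r lerXn2r ?nnegrE//.
  by move: w; near: T.
exact: moment_bounded_cst.
Unshelve. all: by end_near. Qed.

Lemma moments_bounded_near_cst (c : nat -> R) (C : R) :
  (\forall T \near \oo, `|c T| <= C) -> moments_bounded (fun T _ => c T).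
Proof.
move=> cC; split => // k; exists (C ^+ k); near=> T.
have h : `|c T| <= C by near: T.
by rewrite moment_cst lee_fin lerXn2r// nnegrE (le_trans _ h).
Unshelve. all: by end_near. Qed.

Lemma moments_bounded_cst (c : R) : moments_bounded (fun _ _ => c).
Proof. by apply: (@moments_bounded_near_cst _ `|c|); near=> T.
Unshelve. all: by end_near. Qed.

Lemma moment_boundedD k X Y :
  (forall T, measurable_fun setT (X T)) ->
  (forall T, measurable_fun setT (Y T)) ->
  moment_bounded k X -> moment_bounded k Y ->
  moment_bounded k (fun T w => X T w + Y T w).
Proof.
move=> mX mY.
apply: (@moment_bounded_lin k k k _ X Y (2 ^+ k) (2 ^+ k)) => //.
- by move=> T; exact: measurable_funD.
- by near=> T => w; exact: normr_expD_le.
Unshelve. all: by end_near. Qed.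

Lemma moments_boundedD X Y : moments_bounded X -> moments_bounded Y ->
  moments_bounded (fun T w => X T w + Y T w).
Proof.
move=> [mX bX] [mY bY]; split => [T|k]; first exact: measurable_funD.
exact: moment_boundedD.
Qed.

Lemma moments_boundedM X Y : moments_bounded X -> moments_bounded Y ->
  moments_bounded (fun T w => X T w * Y T w).
Proof.
move=> [mX bX] [mY bY]; split => [T|k]; first exact: measurable_funM.
apply: (@moment_bounded_lin (2 * k) (2 * k) k _ X Y (4 * 1)^-1 1) => //.
  by move=> T; exact: measurable_funM.
by near=> T => w; exact: normr_expM_le.
Unshelve. all: by end_near. Qed.


Lemma moment_bounded_sum (I : Type) (s : seq I) k (X : I -> nat -> W -> R) :
  (forall i T, measurable_fun setT (X i T)) ->
  (forall i, moment_bounded k (X i)) ->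
  moment_bounded k (fun T w => \sum_(i <- s) X i T w).
Proof.
move=> mX bX; elim: s => [|i s IH].
  by under eq_fun do under eq_fun do rewrite big_nil; exact: moment_bounded_cst.
under eq_fun do under eq_fun do rewrite big_cons.
by apply: moment_boundedD => // T; exact: measurable_sum.
Qed.

Lemma moments_bounded_sum (I : Type) (s : seq I) (X : I -> nat -> W -> R) :
  (forall i, moments_bounded (X i)) ->
  moments_bounded (fun T w => \sum_(i <- s) X i T w).
Proof.
move=> bX; split => [T|k].
  by apply: measurable_sum => i; exact: (bX i).1.
by apply: moment_bounded_sum => i; [exact: (bX i).1|exact: (bX i).2].
Qed.

Lemma moments_vanish_bounded X : moments_vanish X -> moments_bounded X.
Proof.
move=> [mX vX]; split => // -[|k].
  exists 1; near=> T; rewrite (_ : moment 0 (X T) = moment 0 (cst 0))//.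
  by rewrite moment_cst expr0.
by exists 1; exact: vX.
Unshelve. all: by end_near. Qed.

Lemma moments_vanish_near_cst (c : nat -> R) :
  c T @[T --> \oo] --> 0 -> moments_vanish (fun T _ => c T).
Proof.
move=> c0; split => // k e e0; near=> T.
rewrite moment_cst lee_fin.
(* Of the k + 1 factors, one is bounded by [e] and the others by 1. *)
have h : `|c T| <= Num.min e 1.
  near: T; move/cvgr0Pnorm_le : c0; apply.
  by rewrite lt_min e0 ltr01.
rewrite exprS (@le_trans _ _ (e * 1))//; last by rewrite mulr1.
apply: ler_pM => //.
  by apply: (le_trans h); rewrite ge_min lexx.
by apply: exprn_ile1 => //; apply: (le_trans h); rewrite ge_min lexx orbT.
Unshelve. all: by end_near. Qed.

Lemma moments_vanishD X Y : moments_vanish X -> moments_vanish Y ->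
  moments_vanish (fun T w => X T w + Y T w).
Proof.
move=> [mX vX] [mY vY]; split => [T|k e e0]; first exact: measurable_funD.
have p2 : 0 < 2 ^+ k.+1 :> R by rewrite exprn_gt0.
have e'0 : 0 < e / 2 / 2 ^+ k.+1 by rewrite !divr_gt0.
near=> T; apply: (le_trans (@moment_le_lin _ (X T) (Y T) k.+1 k.+1 k.+1
  (2 ^+ k.+1) (2 ^+ k.+1) _ _ _ _ _ _)) => //.
- exact: measurable_funD.
- by move=> w; exact: normr_expD_le.
have -> : e = 2 ^+ k.+1 * (e / 2 / 2 ^+ k.+1) + 2 ^+ k.+1 * (e / 2 / 2 ^+ k.+1).
  by field; rewrite gt_eqF.
rewrite EFinD !EFinM; apply: leeD; apply: lee_wpmul2l; rewrite ?lee_fin ?(ltW p2)//.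
  by near: T; apply: vX.
by near: T; apply: vY.
Unshelve. all: by end_near. Qed.

(** [normr_expM_le] trades the product for moments of twice the order, which is why all orders are
    controlled together. *)
Lemma moments_vanishM X Y : moments_vanish X -> moments_bounded Y ->
  moments_vanish (fun T w => X T w * Y T w).
Proof.
move=> [mX vX] [mY bY]; split => [T|k e e0]; first exact: measurable_funM.
have [C C0 hC] := moment_boundedP (bY (2 * k.+1)%N).
have C1 : 0 < C + 1 by lra.
(* The term with [Y] then costs at most e / 2; the moment of [X] is pushed below 2 dl e, so that its
   term costs e / 2 as well. C + 1 guards against C = 0. *)
set dl := e / 2 / (C + 1).
have dl0 : 0 < dl by rewrite !divr_gt0.
near=> T; apply: (le_trans (@moment_le_lin _ (X T) (Y T) (2 * k.+1) (2 * k.+1)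
  k.+1 (4 * dl)^-1 dl _ _ _ _ _ _)) => //.
- exact: measurable_funM.
- by rewrite invr_ge0; lra.
- exact: ltW.
- by move=> w; exact: normr_expM_le.
apply: (@le_trans _ _ (((4 * dl)^-1 * (2 * dl * e))%:E + (dl * C)%:E)%E).
  rewrite [X in (_ <= X + _)%E]EFinM [X in (_ <= _ + X)%E]EFinM.
  apply: leeD; apply: lee_wpmul2l; rewrite ?lee_fin ?(ltW dl0)//.
  - by rewrite invr_ge0; lra.
  - near: T; rewrite mulnS; apply: (vX (2 * k).+1).
    by rewrite mulr_gt0// mulr_gt0.
  - by near: T.
rewrite -EFinD lee_fin.
have -> : (4 * dl)^-1 * (2 * dl * e) = e / 2 by field; rewrite gt_eqF.
have : dl * C <= dl * (C + 1) by apply: ler_wpM2l; lra.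
have -> : dl * (C + 1) = e / 2 by rewrite /dl divfK// gt_eqF.
lra.
Unshelve. all: by end_near. Qed.

Lemma moments_vanish_sum (I : Type) (s : seq I) (X : I -> nat -> W -> R) :
  (forall i, moments_vanish (X i)) ->
  moments_vanish (fun T w => \sum_(i <- s) X i T w).
Proof.
move=> vX; elim: s => [|i s IH].
  under eq_fun do under eq_fun do rewrite big_nil.
  by apply: moments_vanish_near_cst; exact: cvg_cst.
under eq_fun do under eq_fun do rewrite big_cons.
exact: moments_vanishD.
Qed.

End Moments.

(** * From convergence in probability to convergence of moments and means *)

Section MomentConvergence.
Context {d : measure_display} {W : measurableType d} {R : realType}.
Variable P : probability W R.
Implicit Types X Y : nat -> W -> R.

Lemma measurable_gt_norm (f : W -> R) e : measurable_fun setT f ->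
  measurable [set w | e < `|f w|].
Proof.
move=> mf; rewrite (_ : [set _ | _] = (fun w => `|f w|) @^-1` `]e, +oo[).
  rewrite -[X in measurable X]setTI; apply: (_ : measurable_fun setT _) => //.
  exact: measurableT_comp.
by apply/seteqP; split => w /=; rewrite in_itv/= andbT.
Qed.

Lemma integral_cst1 (c : R) : (\int[P]_w c%:E = c%:E)%E.
Proof.
rewrite (_ : (fun w => _) = cst c%:E)// integral_cst//.
rewrite [X in (_ * X)%E](_ : _ = 1%E) ?mule1//; exact: probability_setT.
Qed.

Lemma cvge0_near_le (I : Type) (F : set_system I) {FF : Filter F} (f : I -> \bar R)
    (e : R) : f T @[T --> F] --> 0%E -> 0 < e ->
  \forall T \near F, (f T <= e%:E)%E.
Proof.
move=> /fine_cvgP[fA /cvgr0Pnorm_le fc] e0; near=> T.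
have fT : f T \is a fin_num by near: T.
rewrite -(fineK fT) lee_fin; apply: (le_trans (ler_norm _)).
by near: T; exact: fc.
Unshelve. all: by end_near. Qed.

(** Truncation: off the event where |X - l| exceeds [eta] the power is small; on it, [normr_expM_le]
    with one factor equal to 1 bounds the power by a constant plus a small multiple of a bounded
    moment. *)
Lemma moments_vanish_in_probability X (l : R) :
  cvg_in_probability P X l -> moments_bounded P X ->
  moments_vanish P (fun T w => X T w - l).
Proof.
move=> cX bX; have [mY bY] : moments_bounded P (fun T w => X T w - l).
  by apply: moments_boundedD => //; exact: moments_bounded_cst.
split => // k e e0.
set Y := fun T w => X T w - l in mY bY *.
have [C C0 hC] := moment_boundedP (bY (2 * k.+1)%N).
have C1 : 0 < C + 1 by lra.
(* Three errors of e / 3: [dl] handles the moment of double order, [eta] the part where |Y| is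
   small, and the probability of [A T] the rest. As [eta] is at most 1, powers of |Y| remain below
   [eta] off [A T]. *)
set dl := e / 3 / (C + 1); have dl0 : 0 < dl by rewrite !divr_gt0.
pose eta : R := Num.min (e / 3) 1.
have eta0 : 0 < eta by rewrite lt_min ltr01 andbT divr_gt0.
have eta1 : eta <= 1 by rewrite /eta ge_min lexx orbT.
have etae : eta <= e / 3 by rewrite /eta ge_min lexx.
pose A T := [set w | eta < `|Y T w|].
have mA T : measurable (A T) by exact: measurable_gt_norm (mY T).
pose H T w : R := eta + (4 * dl)^-1 * \1_(A T) w.
have i0 : 0 <= (4 * dl)^-1 by rewrite invr_ge0; lra.
have mH T : measurable_fun setT (H T).
  rewrite /H; apply: measurable_funD => //; apply: measurable_funM => //.
have H0 T w : 0 <= H T w by rewrite addr_ge0 ?mulr_ge0// ltW.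
have le1 T w : `|Y T w| ^+ k.+1 <= dl * `|Y T w| ^+ (2 * k.+1) + 1 * H T w.
  rewrite mul1r /H indicE; case: (boolP (w \in A T)) => [_|].
    have := @normr_expM_le R 1 (Y T w) k.+1 dl dl0.
    by rewrite mul1r normr1 !expr1n /= !mulr1; lra.
  rewrite notin_setE /A/= => /negP; rewrite -leNgt => h.
  rewrite mulr0 addr0; apply: ler_wpDl; first by rewrite mulr_ge0 ?(ltW dl0).
  rewrite exprS (le_trans _ h)// ler_piMr//.
  by rewrite exprn_ile1// (le_trans h).
have le2 T : (\int[P]_w (H T w)%:E <= eta%:E + (4 * dl)^-1%:E * P (A T))%E.
  have := @ge0_integral_le_lin _ _ _ P (H T) (cst eta) \1_(A T) 1 (4 * dl)^-1.
  move=> /(_ (mH T)).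
  rewrite integral_cst1 integral_indic// setIT mul1e; apply => //.
  - by move=> w; exact: ltW.
  - by move=> w; rewrite mul1r.
have cA : P (A T) @[T --> \oo] --> 0%E by exact: cX.
near=> T.
have h1 : (moment P (2 * k.+1) (Y T) <= C%:E)%E by near: T.
have h2 : (P (A T) <= (4 * dl * (e / 3))%:E)%E.
  by near: T; apply: (cvge0_near_le cA); rewrite mulr_gt0 ?divr_gt0// mulr_gt0.
have := @ge0_integral_le_lin _ _ _ P (fun w => `|Y T w| ^+ k.+1)
  (fun w => `|Y T w| ^+ (2 * k.+1)) (H T) dl 1.
move=> /(_ (measurable_normX k.+1 (mY T)) (measurable_normX _ (mY T)) (mH T)).
move=> /(_ (ltW dl0) ler01).
move=> h3; apply: (le_trans (h3 _ _ _ _)) => //.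
rewrite mul1e.
apply: (@le_trans _ _ ((dl * C)%:E +
   (eta%:E + ((4 * dl)^-1 * (4 * dl * (e / 3)))%:E))%E).
  apply: leeD.
    by rewrite [X in (_ <= X)%E]EFinM; apply: lee_wpmul2l => //; rewrite lee_fin ltW.
  apply: (le_trans (le2 T)); apply: leeD => //.
  by rewrite [X in (_ <= X)%E]EFinM; apply: lee_wpmul2l.
rewrite -!EFinD lee_fin mulKf ?gt_eqF//; last by lra.
have : dl * C <= dl * (C + 1) by apply: ler_wpM2l; lra.
have -> : dl * (C + 1) = e / 3 by rewrite /dl divfK// gt_eqF.
lra.
Unshelve. all: by end_near. Qed.

Lemma integrable_moment1 (f : W -> R) : measurable_fun setT f ->
  (moment P 1 f < +oo)%E -> P.-integrable setT (EFin \o f).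
Proof.
move=> mf h; apply/integrableP; split; first exact/measurable_EFinP.
by rewrite (eq_integral (fun w => (`|f w| ^+ 1)%:E)).
Qed.

Lemma moments_bounded_integrable X : moments_bounded P X ->
  \forall T \near \oo, P.-integrable setT (EFin \o X T).
Proof.
move=> [mX bX]; have [C hC] := bX 1%N; near=> T.
apply: integrable_moment1 => //; apply: (@le_lt_trans _ _ C%:E).
  by near: T.
by rewrite ltry.
Unshelve. all: by end_near. Qed.

Lemma moments_vanish_sub_bounded X (l : R) :
  moments_vanish P (fun T w => X T w - l) -> moments_bounded P X.
Proof.
move=> vX; rewrite (_ : X = fun T w => (X T w - l) + l).
  by apply: moments_boundedD; [exact: moments_vanish_bounded
                              |exact: moments_bounded_cst].
by apply/funext => T; apply/funext => w; rewrite subrK.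
Qed.

(** |E X - l| is at most E |X - l|, a vanishing first moment; the means are eventually finite, so
    [fine] loses nothing in the limit. *)
Lemma expectation_cvg_of_vanish X (l : R) :
  moments_vanish P (fun T w => X T w - l) ->
  fine (\int[P]_w (X T w)%:E)%E @[T --> \oo] --> l.
Proof.
move=> vX; apply/cvgrPdist_le => e e0.
have bX := moments_vanish_sub_bounded vX.
have h1 := vX.2 0%N _ e0.
near=> T.
have iX : P.-integrable setT (EFin \o X T).
  by near: T; exact: moments_bounded_integrable.
have ic : P.-integrable setT (EFin \o cst l).
  by apply: finite_measure_integrable_cst.
have fX : (\int[P]_w (X T w)%:E)%E \is a fin_num.
  exact: (@integrable_fin_num _ _ _ P setT measurableT (EFin \o X T)).
have E1 : (\int[P]_w ((X T w)%:E - l%:E) = \int[P]_w (X T w)%:E - l%:E)%E.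
  by rewrite (integralB measurableT iX ic)/= integral_cst1.
have -> : l - fine (\int[P]_w (X T w)%:E)%E =
    - fine (\int[P]_w ((X T w)%:E - l%:E))%E.
  by rewrite E1; case: (\int[P]_w (X T w)%:E)%E fX => [r|//|//] _; rewrite /= opprB.
rewrite normrN.
have m1 : (moment P 1 (fun w => (X T w - l)%R) <= e%:E)%E by near: T.
have iB := integrableB measurableT iX ic.
have fB := integrable_fin_num measurableT iB.
rewrite -lee_fin -fine_abse// fineK ?abse_fin_num//.
apply: (le_trans (le_abse_integral _ _ _)) => //.
by have /integrableP[] := iB.
Unshelve. all: by end_near. Qed.

(** One truncation level is enough: if the tails above [K] integrate to at most 1, the rest
    contributes at most |K| under a probability. *)
Lemma uniformly_integrable_moment1 T0 X :
  uniformly_integrable P [set T | (T0 <= T)%N] X ->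
  exists C : R, forall T, (T0 <= T)%N -> (moment P 1 (X T) <= C%:E)%E.
Proof.
move=> [mX cX].
set S := fun K : R => ereal_sup _ in cX.
have [K hK] : exists K : R, (S K <= 1%E)%E.
  have [K hK] := @filter_ex _ (pinfty_nbhs R) _ _ (cvge0_near_le cX ltr01).
  by exists K.
exists (1 + `|K|) => T TT0.
set A := [set w | K < `|X T w|].
have mXT := mX T TT0.
have mA : measurable A by exact: measurable_gt_norm.
have mF : measurable_fun setT (fun w => `|X T w|%:E).
  by apply/measurable_EFinP; exact: measurableT_comp.
have -> : moment P 1 (X T) = (\int[P]_w `|X T w|%:E)%E by [].
rewrite -(setvU A) ge0_integral_setU//; last 3 first.
- exact: measurableC.
- by rewrite setvU.
- by rewrite disj_set2E setICl.
rewrite addeC EFinD; apply: leeD.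
  by apply: le_trans hK; apply: ereal_sup_ubound; exists T.
apply: (@le_trans _ _ (\int[P]_(w in ~` A) `|K|%:E)%E).
  apply: ge0_le_integral => //=.
  - exact: measurableC.
  - exact: measurable_funTS.
  - move=> w /negP; rewrite -leNgt lee_fin => h.
    exact: le_trans h (ler_norm _).
apply: (@le_trans _ _ (\int[P]_w `|K|%:E)%E); last by rewrite integral_cst1.
by apply: ge0_subset_integral => //=; exact: measurableC.
Qed.

End MomentConvergence.

(** * Measurability of matrix-valued maps, inverses included *)

Section MeasurableMatrices.
Context {d : measure_display} {W : measurableType d} {R : realType}.

Lemma measurable_invr : measurable_fun setT (@GRing.inv R).
Proof.
rewrite -(setvU [set (0 : R)]).
apply/measurable_funU => //; first exact: measurableC.
split; last exact: measurable_fun_set1.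
apply: open_continuous_measurable_fun.
  by rewrite openC; exact: closed_eq.
by move=> x; rewrite inE/= => /eqP x0; exact: inv_continuous.
Qed.

Definition mx_measurable m n (A : W -> 'M[R]_(m, n)) :=
  forall i j, measurable_fun setT (fun w => A w i j).

Lemma mx_measurableD m n (A B : W -> 'M[R]_(m, n)) :
  mx_measurable A -> mx_measurable B -> mx_measurable (fun w => A w + B w).
Proof.
by move=> mA mB i j; under eq_fun do rewrite mxE; exact: measurable_funD.
Qed.

Lemma mx_measurableN m n (A : W -> 'M[R]_(m, n)) :
  mx_measurable A -> mx_measurable (fun w => - A w).
Proof.
by move=> mA i j; under eq_fun do rewrite mxE; exact: measurableT_comp.
Qed.

Lemma mx_measurableB m n (A B : W -> 'M[R]_(m, n)) :
  mx_measurable A -> mx_measurable B -> mx_measurable (fun w => A w - B w).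
Proof. by move=> mA mB; apply: mx_measurableD => //; exact: mx_measurableN. Qed.

Lemma mx_measurableZ m n (f : W -> R) (A : W -> 'M[R]_(m, n)) :
  measurable_fun setT f -> mx_measurable A ->
  mx_measurable (fun w => f w *: A w).
Proof.
by move=> mf mA i j; under eq_fun do rewrite mxE; exact: measurable_funM.
Qed.

Lemma mx_measurableM m n q (A : W -> 'M[R]_(m, n)) (B : W -> 'M[R]_(n, q)) :
  mx_measurable A -> mx_measurable B -> mx_measurable (fun w => A w *m B w).
Proof.
move=> mA mB i j; under eq_fun do rewrite mxE.
by apply: measurable_sum => k; exact: measurable_funM.
Qed.

Lemma mx_measurable_tr m n (A : W -> 'M[R]_(m, n)) :
  mx_measurable A -> mx_measurable (fun w => (A w)^T).
Proof. by move=> mA i j; under eq_fun do rewrite mxE; exact: mA. Qed.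

Lemma mx_measurable_sum m n (I : Type) (s : seq I)
    (A : I -> W -> 'M[R]_(m, n)) :
  (forall i, mx_measurable (A i)) -> mx_measurable (fun w => \sum_(i <- s) A i w).
Proof.
move=> mA i j; under eq_fun do rewrite summxE.
by apply: measurable_sum => k; exact: mA.
Qed.

Lemma measurable_det n (A : W -> 'M[R]_n) :
  mx_measurable A -> measurable_fun setT (fun w => \det (A w)).
Proof.
move=> mA; apply: measurable_sum => s; apply: measurable_funM => //.
by apply: measurable_prod => i _; exact: mA.
Qed.

(** Cramer's rule off the zero set of the determinant; on that set [invmx] returns its argument. *)
Lemma mx_measurable_invmx n (A : W -> 'M[R]_n) :
  mx_measurable A -> mx_measurable (fun w => invmx (A w)).
Proof.
move=> mA i j; rewrite /invmx.
rewrite (_ : (fun w => _) = fun w => if \det (A w) == 0 then A w i j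
    else (\det (A w))^-1 * cofactor (A w) j i); last first.
  apply/funext => w; rewrite unitmxE unitfE; case: eqP => //= _.
  by rewrite !mxE.
apply: measurable_fun_ifT => //.
  by apply: measurable_fun_eqr => //; exact: measurable_det.
apply: measurable_funM.
  by apply: measurableT_comp; [exact: measurable_invr|exact: measurable_det].
rewrite /cofactor; apply: measurable_funM => //; apply: measurable_det => k l.
by under eq_fun do rewrite !mxE; exact: mA.
Qed.

End MeasurableMatrices.

(** * Boundedness and convergence of random matrices in all moments *)

Section MatrixMoments.
Context {d : measure_display} {W : measurableType d} {R : realType}.
Variable P : probability W R.

Definition mx_bounded m n (M : nat -> W -> 'M[R]_(m, n)) :=
  forall i j, moments_bounded P (fun T w => M T w i j).

Definition mx_lim m n (M : nat -> W -> 'M[R]_(m, n)) (L : 'M[R]_(m, n)) :=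
  forall i j, moments_vanish P (fun T w => M T w i j - L i j).

Lemma mx_lim_bounded m n (M : nat -> W -> 'M[R]_(m, n)) L :
  mx_lim M L -> mx_bounded M.
Proof.
move=> ML i j; exact: moments_vanish_sub_bounded (ML i j).
Qed.

Lemma mx_lim_in_probability n (M : nat -> W -> 'M[R]_n) L :
  mx_cvg_in_probability P M L -> mx_bounded M -> mx_lim M L.
Proof. by move=> ML bM i j; exact: moments_vanish_in_probability. Qed.

Lemma mx_lim_cst m n (L : 'M[R]_(m, n)) : mx_lim (fun _ _ => L) L.
Proof.
move=> i j; under eq_fun do under eq_fun do rewrite subrr.
by apply: moments_vanish_near_cst; exact: cvg_cst.
Qed.

Lemma mx_limD m n (M N : nat -> W -> 'M[R]_(m, n)) L K :
  mx_lim M L -> mx_lim N K -> mx_lim (fun T w => M T w + N T w) (L + K).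
Proof.
move=> ML NK i j; rewrite (_ : (fun T w => _) =
    fun T w => (M T w i j - L i j) + (N T w i j - K i j)).
  exact: moments_vanishD.
by apply/funext => T; apply/funext => w; rewrite !mxE opprD addrACA.
Qed.

Lemma mx_limM m n q (M : nat -> W -> 'M[R]_(m, n))
    (N : nat -> W -> 'M[R]_(n, q)) L K :
  mx_lim M L -> mx_lim N K -> mx_lim (fun T w => M T w *m N T w) (L *m K).
Proof.
(* The entry of (M - L) N + L (N - K), with the vanishing factor written first. *)
move=> ML NK i j; rewrite (_ : (fun T w => _) = fun T w => \sum_k
    ((M T w i k - L i k) * N T w k j + (N T w k j - K k j) * L i k)).
  apply: moments_vanish_sum => k; apply: moments_vanishD.
    by apply: moments_vanishM => //; exact: mx_lim_bounded NK _ _.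
  by apply: moments_vanishM => //; exact: moments_bounded_cst.
apply/funext => T; apply/funext => w; rewrite !mxE -sumrB.
by apply: eq_bigr => k _; ring.
Qed.

Lemma mx_limZ m n (c : nat -> R) (l : R) (M : nat -> W -> 'M[R]_(m, n)) L :
  c T @[T --> \oo] --> l -> mx_lim M L ->
  mx_lim (fun T w => c T *: M T w) (l *: L).
Proof.
move=> cl ML i j; rewrite (_ : (fun T w => _) = fun T w =>
    (c T - l) * M T w i j + (M T w i j - L i j) * l).
  apply: moments_vanishD.
    apply: moments_vanishM; last exact: mx_lim_bounded ML _ _.
    by apply: moments_vanish_near_cst; rewrite -(subrr l);
       apply: cvgB => //; exact: cvg_cst.
  by apply: moments_vanishM => //; exact: moments_bounded_cst.
by apply/funext => T; apply/funext => w; rewrite !mxE; ring.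
Qed.

Lemma mx_limB m n (M N : nat -> W -> 'M[R]_(m, n)) L K :
  mx_lim M L -> mx_lim N K -> mx_lim (fun T w => M T w - N T w) (L - K).
Proof.
move=> ML NK; apply: mx_limD => //; rewrite -scaleN1r.
under eq_fun do under eq_fun do rewrite -scaleN1r.
by apply: mx_limZ => //; exact: cvg_cst.
Qed.

Lemma moments_vanish_trace n (M : nat -> W -> 'M[R]_n) L :
  mx_lim M L -> moments_vanish P (fun T w => \tr (M T w) - \tr L).
Proof.
move=> ML; rewrite /mxtrace.
under eq_fun do under eq_fun do rewrite -sumrB.
by apply: moments_vanish_sum => i; exact: ML.
Qed.

Lemma moments_bounded_trace n (M : nat -> W -> 'M[R]_n) :
  mx_bounded M -> moments_bounded P (fun T w => \tr (M T w)).
Proof. by move=> bM; apply: moments_bounded_sum => i; exact: bM. Qed.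

(** The power A^(2^k), squaring the argument first so that an induction can replace a matrix by its
    square. *)
Fixpoint mx_sqiter n (k : nat) (A : 'M[R]_n) : 'M[R]_n :=
  if k is k'.+1 then mx_sqiter k' (A *m A) else A.

Lemma mx_sqiter_nseq n (k : nat) (A : 'M[R]_n) :
  mx_sqiter k A = \big[mulmx/1%:M]_(i <- nseq (2 ^ k) tt) A.
Proof.
have E q (B : 'M[R]_n) : \big[mulmx/1%:M]_(i <- nseq (2 * q) tt) B =
    \big[mulmx/1%:M]_(i <- nseq q tt) (B *m B).
  elim: q => [|q IH]; first by rewrite muln0 !big_nil.
  by rewrite mulnS [nseq _ _]/= !big_cons IH mulmxA.
elim: k A => [|k IH] A; first by rewrite /= big_cons big_nil mulmx1.
by rewrite /= IH expnS E.
Qed.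

(** For symmetric [A], tr (A A) is the sum of the squares of all entries. *)
Lemma sym_entry_sqr_le n (A : 'M[R]_n) i j : A^T = A ->
  A i j ^+ 2 <= \tr (A *m A).
Proof.
move=> sA; rewrite /mxtrace (bigD1 i)//= mxE (bigD1 j)//=.
have E a b : A a b * A b a = A a b ^+ 2 by rewrite -[in A b a]sA mxE expr2.
rewrite E -addrA lerDl addr_ge0//; apply: sumr_ge0 => k _.
  by rewrite E sqr_ge0.
by rewrite mxE; apply: sumr_ge0 => l _; rewrite E sqr_ge0.
Qed.

(* By sym_entry_sqr_le, the moment of order 2^(k+1) of an entry of M is
   controlled by the moments of order 2^k of M *m M. *)
Lemma moment_bounded_sym n (k : nat) (M : nat -> W -> 'M[R]_n) :
  (forall T, mx_measurable (M T)) ->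
  (forall T w, (M T w)^T = M T w) ->
  (forall i j, moment_bounded P 1 (fun T w => mx_sqiter k (M T w) i j)) ->
  forall i j, moment_bounded P (2 ^ k) (fun T w => M T w i j).
Proof.
elim: k M => [//|k IH] M mM sM bM i j.
have mMM T : mx_measurable (fun w => M T w *m M T w) by exact: mx_measurableM.
have {}IH : forall i j,
    moment_bounded P (2 ^ k) (fun T w => (M T w *m M T w) i j).
  by apply: IH => // T w; rewrite trmx_mul sM.
have IHt : moment_bounded P (2 ^ k) (fun T w => \tr (M T w *m M T w)).
  by apply: moment_bounded_sum => // l T; exact: mMM.
have mt T : measurable_fun setT (fun w => \tr (M T w *m M T w)).
  by apply: measurable_sum => l; exact: mMM.
apply: (@moment_bounded_lin _ _ _ P (2 ^ k) 0 (2 ^ k.+1) _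
  (fun T w => \tr (M T w *m M T w)) (fun _ _ => 0) 1 0) => //.
- by move=> T; exact: mM.
- near=> T => w; rewrite mul0r addr0 mul1r expnS exprM.
  rewrite lerXn2r ?nnegrE ?exprn_ge0// -normrX ger0_norm ?sqr_ge0//.
  by apply: (le_trans (sym_entry_sqr_le _ _ _)) => //; exact: ler_norm.
- exact: moment_bounded_cst.
Unshelve. all: by end_near. Qed.

(** Dyadic orders suffice, since k < 2^k. *)
Lemma mx_bounded_sym n (M : nat -> W -> 'M[R]_n) :
  (forall T, mx_measurable (M T)) ->
  (forall T w, (M T w)^T = M T w) ->
  (forall k i j, moment_bounded P 1 (fun T w => mx_sqiter k (M T w) i j)) ->
  mx_bounded M.
Proof.
move=> mM sM bM i j; split => [T|k]; first exact: mM.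
(* The additive constant 1 enters as the zeroth power of the zero variable. *)
apply: (@moment_bounded_lin _ _ _ P (2 ^ k) 0 k _ (fun T w => M T w i j)
  (fun _ _ => 0) 1 1) => //.
- by move=> T; exact: mM.
- by move=> T; exact: mM.
- near=> T => w; rewrite !mul1r expr0; apply: normr_exp_le1D.
  exact/ltnW/ltn_expl.
- exact: moment_bounded_sym.
- exact: moment_bounded_cst.
Unshelve. all: by end_near. Qed.

End MatrixMoments.

(** * Laws of processes as measures on path space *)

Section PathSpace.
Context {R : realType}.

Definition coordinate_sets (I : Type) : set_system (I -> R) :=
  [set A | exists i : I, exists2 B : set R,
     measurable B & A = [set f | B (f i)]].

(** R^I with the sigma-algebra of [product_sigma], packaged as a measurable type so that laws of
    processes are image measures. *)
Definition pathspace (I : Type) := g_sigma_algebraType (@coordinate_sets I).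

Lemma measurable_coordinate (I : Type) (i : I) :
  measurable_fun setT (fun f : pathspace I => f i).
Proof.
move=> _ B mB; rewrite setTI; apply: sub_sigma_algebra.
by exists i; exists B.
Qed.

Context {d : measure_display} {W : measurableType d}.

Lemma measurable_path (I : Type) (X : I -> W -> R) :
  (forall i, measurable_fun setT (X i)) ->
  measurable_fun setT (fun w => (X ^~ w) : pathspace I).
Proof.
move=> mX; apply: (@measurability _ _ W (pathspace I) setT _ (@coordinate_sets I)) => //.
move=> _ [_ [i [B mB ->]] <-]; exact: mX.
Qed.

Variable P : probability W R.

Definition path_mfun (I : Type) (X : I -> W -> R)
    (mX : forall i, measurable_fun setT (X i)) : {mfun W >-> pathspace I} :=
  mfun_Sub (mem_set (measurable_path mX)).

Lemma same_law_integral (I : Type) (X Y : I -> W -> R) (g : pathspace I -> \bar R) :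
  (forall i, measurable_fun setT (X i)) ->
  (forall i, measurable_fun setT (Y i)) -> same_law P X Y ->
  measurable_fun setT g -> (forall f, 0 <= g f)%E ->
  (\int[P]_w g (X ^~ w) = \int[P]_w g (Y ^~ w))%E.
Proof.
move=> mX mY XY mg g0.
transitivity (\int[distribution P (path_mfun mX)]_f g f)%E.
  by rewrite ge0_integral_distribution.
transitivity (\int[distribution P (path_mfun mY)]_f g f)%E.
  by apply: eq_measure_integral => A mA _; exact: XY.
by rewrite ge0_integral_distribution.
Qed.

Lemma independent_integral (I J : Type) (X : I -> W -> R) (Y : J -> W -> R)
    (g : pathspace I * pathspace J -> \bar R) :
  (forall i, measurable_fun setT (X i)) ->
  (forall i, measurable_fun setT (Y i)) -> independent P X Y ->
  measurable_fun setT g -> (forall f, 0 <= g f)%E ->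
  (\int[P]_w g (X ^~ w, Y ^~ w) =
   \int[P]_w1 \int[P]_w2 g (X ^~ w1, Y ^~ w2))%E.
Proof.
move=> mX mY XY mg g0.
pose mX' := path_mfun mX; pose mY' := path_mfun mY.
have mXY : measurable_fun setT (fun w => (X ^~ w, Y ^~ w) : pathspace I * pathspace J).
  by apply: measurable_fun_pair; exact: measurable_path.
pose mXY' : {mfun W >-> (pathspace I * pathspace J)%type} := mfun_Sub (mem_set mXY).
transitivity (\int[distribution P mXY']_f g f)%E.
  by rewrite ge0_integral_distribution.
(* A product measure is determined by rectangles, on which the joint law factors by independence. *)
transitivity (\int[distribution P mX' \x distribution P mY']_f g f)%E.
  apply: eq_measure_integral => A mA _; apply/esym.
  apply: product_measure_unique => //.
rewrite fubini_tonelli1//.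
rewrite ge0_integral_distribution//; last 2 first.
- exact: measurable_fun_fubini_tonelli_F.
- by move=> f; apply: integral_ge0.
apply: eq_integral => w1 _; rewrite /= /fubini_F.
rewrite ge0_integral_distribution//.
by apply: measurableT_comp => //; exact: pair1_measurable.
Qed.

End PathSpace.

(** * Transfer along almost sure equality and equality of moments; limits of inverses *)

Section AlmostSure.
Context {d : measure_display} {W : measurableType d} {R : realType}.
Variable P : probability W R.

Lemma moments_vanish_ae (X Y : nat -> W -> R) :
  (forall T, measurable_fun setT (Y T)) -> moments_vanish P X ->
  (\forall T \near \oo, {ae P, forall w, X T w = Y T w}) ->
  moments_vanish P Y.
Proof.
move=> mY [mX vX] XY; split => // k e e0; near=> T.
rewrite (_ : moment P _ _ = moment P k.+1 (X T)); first by near: T; exact: vX.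
apply: ge0_ae_eq_integral => //.
- by apply/measurable_EFinP; exact: measurable_normX.
- by apply/measurable_EFinP; exact: measurable_normX.
have : {ae P, forall w, X T w = Y T w} by near: T.
by apply: filterS => w -> _.
Unshelve. all: by end_near. Qed.

(** M^-1 - L^-1 = M^-1 (L - M) L^-1 has a bounded, a vanishing and a constant factor; the identity
    holds wherever [M] is invertible, hence almost surely for large T. *)
Lemma mx_lim_invmx n (M : nat -> W -> 'M[R]_n) L :
  L \in unitmx -> mx_lim P M L -> mx_bounded P (fun T w => invmx (M T w)) ->
  (\forall T \near \oo, {ae P, forall w, M T w \in unitmx}) ->
  mx_lim P (fun T w => invmx (M T w)) (invmx L).
Proof.
move=> uL ML bM uM i j.
pose N T w := invmx (M T w) *m (L - M T w) *m invmx L.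
have : mx_lim P N 0.
  have H : mx_lim P (fun T w => L - M T w) 0.
    by rewrite -(subrr L); apply: mx_limB => //; exact: mx_lim_cst.
  move=> k l; rewrite (_ : (fun T w => _) = fun T w =>
      \sum_b (\sum_a (L - M T w) a b * invmx (M T w) k a) * invmx L b l).
    apply: moments_vanish_sum => b; apply: moments_vanishM.
      apply: moments_vanish_sum => a; apply: moments_vanishM => //.
      by have := H a b; under eq_fun do under eq_fun do rewrite [X in _ - X]mxE subr0.
    exact: moments_bounded_cst.
  apply/funext => T; apply/funext => w; rewrite [X in _ - X]mxE subr0 !mxE.
  apply: eq_bigr => b _; congr (_ * _); rewrite !mxE; apply: eq_bigr => a _.
  by rewrite mulrC.
move=> /(_ i j); under eq_fun do under eq_fun do rewrite [X in _ - X]mxE subr0.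
move/moments_vanish_ae; apply.
  by move=> T; apply: measurable_funD => //; exact: (bM i j).1.
apply: filterS uM => T; apply: filterS => w uMw.
rewrite /N mulmxBr mulVmx// mulmxBl mul1mx -mulmxA mulmxV// mulmx1.
by rewrite !mxE.
Qed.

Lemma mx_lim_near_eq m q (M N : nat -> W -> 'M[R]_(m, q)) L :
  (forall T, mx_measurable (N T)) -> mx_lim P M L ->
  (\forall T \near \oo, forall w, M T w = N T w) -> mx_lim P N L.
Proof.
move=> mN ML MN i j; apply: (moments_vanish_ae _ (ML i j)).
  by move=> T; apply: measurable_funD => //; exact: mN.
by apply: filterS MN => T MN; apply: aeW => w; rewrite MN.
Qed.

(** Vanishing depends on the moments alone, so that stationarity can carry it from one window to
    another. *)
Lemma moments_vanish_near_moment (X Y : nat -> W -> R) :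
  (forall T, measurable_fun setT (Y T)) -> moments_vanish P X ->
  (\forall T \near \oo, forall k, moment P k (X T) = moment P k (Y T)) ->
  moments_vanish P Y.
Proof.
move=> mY [_ vX] XY; split => // k e e0; near=> T.
have <- : moment P k.+1 (X T) = moment P k.+1 (Y T) by move: k.+1; near: T.
by near: T; exact: vX.
Unshelve. all: by end_near. Qed.

End AlmostSure.

(** * Partial sums of matrices and sums of their squares *)

Section PartialSums.
Context {R : realFieldType} {p : nat}.
Implicit Types (X : nat -> 'M[R]_p) (n k : nat).

Definition psum X n : 'M[R]_p := \sum_(i < n) X i.
Definition ppsum X n : 'M[R]_p := \sum_(k < n) psum X k.+1.

(** For outer products counted from t - n, the sum of the C_k^2 with k <= t, the zero term k = t - n
    being left out. [upper_gram], counted from t + 1, is the sum of those with k > t. *)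
Definition lower_gram X n : 'M[R]_p :=
  \sum_(k < n) psum X k.+1 *m psum X k.+1.
Definition upper_gram X n : 'M[R]_p :=
  \sum_(k < n) (psum X n - psum X k) *m (psum X n - psum X k).

Lemma psumS X n : psum X n.+1 = psum X n + X n.
Proof. by rewrite /psum big_ord_recr. Qed.

(** X_i occurs in the partial sums of lengths i + 1 to n. *)
Lemma ppsumE X n : ppsum X n = \sum_(i < n) X i *+ (n - i).
Proof.
elim: n => [|n IH]; first by rewrite /ppsum !big_ord0.
rewrite /ppsum big_ord_recr/= -/(ppsum X n) IH [RHS]big_ord_recr/=.
rewrite subSnn mulr1n psumS addrA; congr (_ + _).
rewrite -big_split/=; apply: eq_bigr => i _.
by rewrite subSn ?mulrSr// ltnW.
Qed.

(* Abel summation *)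
Lemma lower_gramE X n : lower_gram X n = psum X n *m ppsum X n -
  \sum_(i < n) X i *m \sum_(j < i.+1) X j *+ (i - j).
Proof.
elim: n => [|n IH].
  by rewrite /lower_gram /psum !big_ord0 mul0mx subr0.
rewrite /lower_gram big_ord_recr/= -/(lower_gram X n) IH big_ord_recr/=.
rewrite /ppsum [in RHS]big_ord_recr/= -/(ppsum X n).
(* In the new outer term the weight at j = n is 0, so its inner sum is [ppsum X n]. *)
rewrite [in X in _ - (_ + _ *m X)]big_ord_recr/= subnn mulr0n addr0 -ppsumE.
rewrite mulmxDr [in psum X n.+1 *m ppsum X n]psumS mulmxDl.
set a := psum X n *m _; set b := \sum_(i < n) _; set c := X n *m _.
set g := psum X n.+1 *m _.
by apply/matrixP => i j; rewrite !mxE; ring.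
Qed.

(** Expand the square. Here k runs from 0, in [ppsum] and [lower_gram] from 1: each of the two cross
    terms returns one square of [psum X n] and the last term takes one away, whence n + 1 in place
    of n. *)
Lemma upper_gramE X n : upper_gram X n = (psum X n *m psum X n) *+ n.+1 -
  psum X n *m ppsum X n - ppsum X n *m psum X n + lower_gram X n.
Proof.
have E1 : \sum_(k < n) psum X k = ppsum X n - psum X n.
  have : \sum_(k < n.+1) psum X k = ppsum X n.
    by rewrite big_ord_recl {1}/psum big_ord0 add0r.
  by rewrite big_ord_recr/= => <-; rewrite addrK.
have E2 : \sum_(k < n) psum X k *m psum X k =
    lower_gram X n - psum X n *m psum X n.
  have : \sum_(k < n.+1) psum X k *m psum X k = lower_gram X n.
    by rewrite big_ord_recl {1}/psum big_ord0 mul0mx add0r.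
  by rewrite big_ord_recr/= => <-; rewrite addrK.
rewrite /upper_gram.
under eq_bigr do rewrite mulmxBl !mulmxBr opprB.
rewrite big_split/= sumrB sumr_const card_ord -mulmx_sumr E1.
rewrite sumrB E2 -mulmx_suml E1 mulmxBr mulmxBl mulrSr.
set a := psum X n *m psum X n; set b := psum X n *m _; set c := _ *m psum X n.
set g := lower_gram X n.
rewrite !opprB -!addrA; congr (_ + _).
by apply/matrixP => i j; rewrite !mxE; ring.
Qed.

End PartialSums.

(** * The averages of condition (c) as functions of a vector sequence *)

Section WindowMatrices.
Context {R : realType} {p : nat}.
Implicit Types (V : nat -> 'cV[R]_p) (n k : nat).

Definition outer V i : 'M[R]_p := V i *m (V i)^T.

Lemma outer_sym V i : (outer V i)^T = outer V i.
Proof. by rewrite /outer trmx_mul trmxK. Qed.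

Lemma outerE V i a b : outer V i a b = V i a 0 * V i b 0.
Proof. by rewrite mxE big_ord1 mxE. Qed.

(** Off the diagonal, |v_a v_b| is at most v_a^2 + v_b^2, two of the nonnegative diagonal
    entries. *)
Lemma outer_entry_le V i a b : `|outer V i a b| <= \tr (outer V i).
Proof.
have h c : 0 <= outer V i c c by rewrite outerE -expr2 sqr_ge0.
have [<-|ab] := eqVneq a b.
  by rewrite ger0_norm// /mxtrace (bigD1 a)//= lerDl sumr_ge0.
rewrite /mxtrace (bigD1 a)//= (bigD1 b) 1?eq_sym//= addrA.
apply: (@le_trans _ _ (outer V i a a + outer V i b b)); last first.
  by rewrite lerDl sumr_ge0.
rewrite !outerE ler_norml; have := sqr_ge0 (V i a 0 - V i b 0).
have := sqr_ge0 (V i a 0 + V i b 0); nra.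
Qed.

Lemma outer_tr_ge0 V i : 0 <= \tr (outer V i).
Proof. by apply: sumr_ge0 => c _; rewrite outerE -expr2 sqr_ge0. Qed.

Lemma weighted_outer_entry_le V n (c : nat -> R) a b :
  (forall i, (i < n)%N -> `|c i| <= 1) ->
  `|(\sum_(i < n) c i *: outer V i) a b| <= \tr (psum (outer V) n).
Proof.
move=> c1; rewrite summxE raddf_sum/=; apply: (le_trans (ler_norm_sum _ _ _)).
apply: ler_sum => i _; rewrite mxE normrM -[leRHS]mul1r.
by apply: ler_pM => //; [exact: c1|exact: outer_entry_le].
Qed.

(** [Lam], [Lbar] and [Xih] are the averages of condition (c) with index 0 standing for t - n.
    Depending on [V] alone, they can be moved in time by stationarity. *)
Definition Lam n V : 'M[R]_p := n%:R^-1 *: psum (outer V) n.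
Definition Lbar n V : 'M[R]_p :=
  n%:R^-1 *: \sum_(j < n) ((n - j)%:R / n%:R) *: outer V j.
Definition Xih n V : 'M[R]_p :=
  n%:R^-1 *: \sum_(i < n) (outer V i *m (n%:R^-1 *:
    \sum_(j < i.+1) ((i - j)%:R / n%:R) *: outer V j)).
Definition Glow n V : 'M[R]_p := n%:R^-1 ^+ 3 *: lower_gram (outer V) n.
Definition Gup n V : 'M[R]_p := n%:R^-1 ^+ 3 *: upper_gram (outer V) n.

Lemma LbarE n V : Lbar n V = n%:R^-1 ^+ 2 *: ppsum (outer V) n.
Proof.
rewrite /Lbar ppsumE expr2 -scalerA; congr (_ *: _); rewrite scaler_sumr.
by apply: eq_bigr => j _; rewrite mulrC -scalerA scaler_nat.
Qed.

Lemma GlowE n V : Glow n V = Lam n V *m Lbar n V - Xih n V.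
Proof.
rewrite /Glow lower_gramE LbarE /Lam /Xih scalerBr.
rewrite -scalemxAl -scalemxAr scalerA -exprS; congr (_ - _).
rewrite exprS -scalerA; congr (_ *: _); rewrite scaler_sumr.
apply: eq_bigr => i _; rewrite expr2 -scalerA scalemxAr scalemxAr.
congr (_ *m (_ *: _)); rewrite scaler_sumr.
by apply: eq_bigr => j _; rewrite mulrC -scalerA scaler_nat.
Qed.

Lemma GupE n V : (0 < n)%N -> Gup n V = (1 + n%:R^-1) *: (Lam n V *m Lam n V) -
  Lam n V *m Lbar n V - Lbar n V *m Lam n V + Glow n V.
Proof.
move=> n0; rewrite /Gup upper_gramE LbarE /Lam /Glow.
rewrite -!scalemxAl -!scalemxAr !scalerA -[_ *+ n.+1]scaler_nat.
set A := psum _ n *m psum _ n; set B := _ *m ppsum _ n; set C := ppsum _ n *m _.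
have n1 : n%:R != 0 :> R by rewrite pnatr_eq0 -lt0n.
have nE : n%:R^-1 ^+ 3 * n.+1%:R = (1 + n%:R^-1) * n%:R^-1 * n%:R^-1 :> R.
  by rewrite -natr1; field.
apply/matrixP => i j; rewrite !mxE mulrDr !mulrBr mulrA nE.
by ring.
Qed.

End WindowMatrices.

Lemma big_option (V : nmodType) (I : finType) (F : option I -> V) :
  \sum_o F o = F None + \sum_i F (Some i).
Proof.
rewrite (bigD1 None)//=; congr (_ + _).
rewrite (reindex_omap Some id)/=; last by case.
by apply: eq_bigl => i; rewrite eqxx.
Qed.

(** * Coefficients of the noise in the estimation error *)

Section ErrorCoefficients.
Context {R : realType} {p : nat}.
Implicit Types (V : nat -> 'cV[R]_p) (n k N : nat).

(* Coefficient of u_k in T^(1/2) sum_i x_i x_i' (beta_i - beta_t), times and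
   windows being counted from t - n. *)
Definition drift n N V k : 'M[R]_p :=
  \sum_(i < N) (((k <= i)%N : nat)%:R - ((k <= n)%N : nat)%:R) *: outer V i.

(** The vector that component [o] of the noise at time k multiplies in the error, [kappa] standing
    for T^(-1/2); component b of u_k picks column b of its matrix coefficient. *)
Definition error_coef (kappa : R) n N V k (o : option 'I_p) : 'cV[R]_p :=
  let S := invmx (psum (outer V) N) in
  if o is Some b then kappa *: col b (S *m drift n N V k) else S *m V k.

Lemma drift_low n N V k : (k <= n)%N -> (k <= N)%N ->
  drift n N V k = - psum (outer V) k.
Proof.
move=> kn kN; rewrite /drift kn /psum.
rewrite (big_ord_widen N (fun i => outer V i) kN) [in RHS]big_mkcond/= -sumrN.
apply: eq_bigr => i _; rewrite ltnNge.
by case: (k <= i)%N; rewrite /= ?subrr ?scale0r ?oppr0// sub0r scaleN1r.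
Qed.

Lemma drift_high n N V k : (n < k)%N -> (k <= N)%N ->
  drift n N V k = psum (outer V) N - psum (outer V) k.
Proof.
move=> nk kN; rewrite /drift leqNgt nk /psum.
rewrite (big_ord_widen N (fun i => outer V i) kN) [X in _ - X]big_mkcond/= -sumrB.
apply: eq_bigr => i _; rewrite ltnNge subr0.
by case: (k <= i)%N; rewrite /= ?subrr ?scale0r ?scale1r ?subr0.
Qed.

Lemma psum_sym V n : (psum (outer V) n)^T = psum (outer V) n.
Proof. by rewrite /psum raddf_sum; apply: eq_bigr => i _; exact: outer_sym. Qed.

Lemma drift_sym n N V k : (drift n N V k)^T = drift n N V k.
Proof.
rewrite /drift raddf_sum; apply: eq_bigr => i _.
by rewrite /= linearZ/= outer_sym.
Qed.

(** The first coefficient is zero, the next n are minus the partial sums, and the last n are tails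
    of the window restarted at t + 1. *)
Lemma sum_drift_sqr n V :
  \sum_(k < (n + n).+1) drift n (n + n).+1 V k *m drift n (n + n).+1 V k =
  lower_gram (outer V) n + upper_gram (outer (fun i => V (n.+1 + i)%N)) n.
Proof.
rewrite -addSn big_split_ord/=; congr (_ + _).
  rewrite big_ord_recl/= drift_low// {1}/psum big_ord0 oppr0 mul0mx add0r.
  apply: eq_bigr => i _; rewrite /bump/= add1n.
  by rewrite drift_low ?mulNmx ?mulmxN ?opprK//; have := ltn_ord i; lia.
apply: eq_bigr => i _.
have E : drift n (n.+1 + n) V (n.+1 + i) =
    psum (outer (fun i => V (n.+1 + i)%N)) n -
    psum (outer (fun i => V (n.+1 + i)%N)) i.
  rewrite drift_high; [|lia|by have := ltn_ord i; lia].
  by rewrite /psum !big_split_ord/= opprD addrACA subrr add0r.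
by rewrite E.
Qed.

Lemma sum_sqr_trace m q (A : 'M[R]_(m, q)) :
  \sum_i \sum_j A i j ^+ 2 = \tr (A *m A^T).
Proof.
by apply: eq_bigr => i _; rewrite mxE; apply: eq_bigr => j _; rewrite mxE expr2.
Qed.

(** The squared entries of a matrix A sum to tr (A A'). In the eps part the sum of the x_k x_k' is S
    itself and cancels one of the two inverses. *)
Lemma error_coef_energy kappa n V (se su : R) :
  let N := (n + n).+1 in let S := psum (outer V) N in S \in unitmx ->
  \sum_(a < p) \sum_(k < N) \sum_o error_coef kappa n N V k o a 0 ^+ 2 *
     (if o is Some _ then su else se) =
  kappa ^+ 2 * su * \tr (invmx S *m (lower_gram (outer V) n +
     upper_gram (outer (fun i => V (n.+1 + i)%N)) n) *m invmx S) +
  se * \tr (invmx S).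
Proof.
move=> N S uS; have sS : (invmx S)^T = invmx S by rewrite trmx_inv psum_sym.
transitivity (\sum_(k < N) (kappa ^+ 2 * su * \tr (invmx S *m
    (drift n N V k *m drift n N V k) *m invmx S) +
    se * \tr (invmx S *m outer V k *m invmx S))).
  rewrite exchange_big/=; apply: eq_bigr => k _.
  transitivity (kappa ^+ 2 * su * (\sum_i \sum_j
      (invmx S *m drift n N V k) i j ^+ 2) +
      se * \sum_i \sum_j (invmx S *m V k) i j ^+ 2).
    rewrite !mulr_sumr -big_split/=; apply: eq_bigr => a _.
    rewrite big_option/= addrC mulr_sumr; congr (_ + _).
      by apply: eq_bigr => b _; rewrite !mxE; ring.
    by rewrite big_ord1 mulrC.
  rewrite !sum_sqr_trace !trmx_mul sS drift_sym.
  by rewrite /outer !mulmxA.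
rewrite big_split/= -!mulr_sumr; congr (_ * _ + _ * _).
  by rewrite -raddf_sum/= -mulmx_suml -mulmx_sumr sum_drift_sqr.
rewrite -raddf_sum/= -mulmx_suml -mulmx_sumr -/(psum (outer V) N) -/S.
by rewrite mulVmx// mul1mx.
Qed.

End ErrorCoefficients.

(** * The model and its averages in window coordinates *)

Section WindowRewriting.
Context {d : measure_display} {W : measurableType d} {R : realType}.
Variables (P : probability W R) (p : nat).
Variables (x u : nat -> 'I_p -> {RV P >-> R}) (eps : nat -> {RV P >-> R}).
Implicit Types (T n t s : nat) (w : W).

Definition window s w : nat -> 'cV[R]_p := fun i => vec x (s + i) w.

Lemma window_sumE n t w : (n < t)%N ->
  window_sum x n t w = psum (outer (window (t - n) w)) (n + n).+1.
Proof.
move=> nt; rewrite /window_sum -{1}[(t - n)%N]add0n big_addn big_mkord /psum.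
rewrite (_ : ((t + n).+1 - (t - n))%N = (n + n).+1); last by lia.
by apply: eq_bigr => i _; rewrite /outer /window /xx addnC.
Qed.

Lemma Lambda_hatE n t w : (n < t)%N ->
  Lambda_hat x n t w = Lam n (window (t - n) w).
Proof.
move=> nt; rewrite /Lambda_hat /Lam -{1}[(t - n)%N]add0n big_addn big_mkord.
rewrite (_ : (t - (t - n))%N = n); last by lia.
by congr (_ *: _); apply: eq_bigr => i _; rewrite /outer /window /xx addnC.
Qed.

Lemma Lambda_bar_hatE n t w : (n < t)%N ->
  Lambda_bar_hat x n t w = Lbar n (window (t - n) w).
Proof.
move=> nt; rewrite /Lambda_bar_hat /Lbar; congr (_ *: _).
rewrite -{1}[1%N]add0n big_addn subn1/= big_mkord.
(* This average runs backwards from t, the window forwards from t - n. *)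
rewrite (reindex_inj rev_ord_inj)/=; apply: eq_bigr => i _.
have := ltn_ord i => lt_in.
rewrite /outer /window /xx.
rewrite (_ : (n - i.+1 + 1)%N = (n - i)%N); last by lia.
by rewrite (_ : (t - (n - i))%N = (t - n + i)%N); last by lia.
Qed.

Lemma Xi_hatE n t w : (n < t)%N ->
  Xi_hat x n t w = Xih n (window (t - n) w).
Proof.
move=> nt; rewrite /Xi_hat /Xih; congr (_ *: _).
rewrite -{1}[(t - n)%N]add0n big_addn big_mkord.
rewrite (_ : (t - (t - n))%N = n); last by lia.
apply: eq_bigr => i _; rewrite /outer /window /xx addnC; congr (_ *m (_ *: _)).
rewrite -{1}[(t - n)%N]add0n big_addn big_mkord.
rewrite (_ : ((t - n + i).+1 - (t - n))%N = i.+1); last by lia.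
apply: eq_bigr => j _; rewrite [(j + _)%N]addnC; congr ((_%:R / _) *: _).
by lia.
Qed.

Lemma mulmx_scalar11 (v : 'cV[R]_p) (M : 'M[R]_1) : M 0 0 *: v = v *m M.
Proof. by rewrite {2}[M]mx11_scalar mul_mx_scalar. Qed.

Lemma beta_windowE T s i : (0 < s)%N -> forall w,
  beta u T (s + i) w = beta u T s.-1 w + (Num.sqrt T%:R)^-1 *:
    \sum_(k < i.+1) vec u (s + k) w.
Proof.
move=> s0 w; rewrite /beta -scalerDr; congr (_ *: _).
rewrite (@big_cat_nat _ _ _ s.-1.+1)/=; [|by lia|by lia].
congr (_ + _); rewrite prednK// -{1}[s]add0n big_addn big_mkord.
rewrite (_ : ((s + i).+1 - s)%N = i.+1); last by lia.
by apply: eq_bigr => k _; rewrite addnC.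
Qed.

Lemma beta_diff T s N i n w : (0 < s)%N -> (i < N)%N -> (n < N)%N ->
  beta u T (s + i) w - beta u T (s + n) w = (Num.sqrt T%:R)^-1 *:
   \sum_(k < N) (((k <= i)%N : nat)%:R - ((k <= n)%N : nat)%:R) *:
      vec u (s + k) w.
Proof.
move=> s0 iN nN; rewrite !beta_windowE// opprD addrACA subrr add0r -scalerBr.
congr (_ *: _); under [RHS]eq_bigr do rewrite scalerBl.
have H j : (j < N)%N -> \sum_(k < j.+1) vec u (s + k) w =
    \sum_(k < N) ((k <= j)%N : nat)%:R *: vec u (s + k) w.
  move=> jN; rewrite (big_ord_widen N (fun k => vec u (s + k) w))//.
  rewrite big_mkcond/=; apply: eq_bigr => k _; rewrite ltnS.
  by case: (k <= j)%N; rewrite ?scale1r ?scale0r.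
by rewrite sumrB !H.
Qed.

Lemma estimation_errorE T n t w : (n < t)%N -> window_sum x n t w \in unitmx ->
  beta_hat x u eps T n t w - beta u T t w =
  \sum_(k < (n + n).+1) \sum_o eps_u u eps (t - n + k) o w *:
    error_coef (Num.sqrt T%:R)^-1 n (n + n).+1 (window (t - n) w) k o.
Proof.
move=> nt; set S := window_sum x n t w => uS.
set V := window (t - n) w; set N := (n + n).+1.
have SE : S = psum (outer V) N by exact: window_sumE.
set kap := (Num.sqrt T%:R)^-1.
have tE : t = (t - n + n)%N by lia.
have s0 : (0 < t - n)%N by lia.
(* Written as S^-1 S beta_t, the target shares the factor S^-1 with the estimator. *)
have -> : beta u T t w = invmx S *m \sum_(i < N) (outer V i *m beta u T t w).
  by rewrite -mulmx_suml -/(psum (outer V) N) -SE mulmxA mulVmx// mul1mx.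
rewrite /beta_hat -/S -mulmxBr.
transitivity (invmx S *m (\sum_(k < N) (kap *: (drift n N V k *m
    vec u (t - n + k) w) + eps (t - n + k)%N w *: V k))).
  congr (_ *m _).
  rewrite -{1}[(t - n)%N]add0n big_addn big_mkord.
  rewrite (_ : ((t + n).+1 - (t - n))%N = N); last by rewrite /N; lia.
  transitivity (\sum_(i < N) (outer V i *m (beta u T (t - n + i) w - beta u T t w)
      + eps (t - n + i)%N w *: V i)).
    rewrite -sumrB; apply: eq_bigr => i _; rewrite [(i + _)%N]addnC /y scalerDl.
    rewrite mulmx_scalar11 mulmxA -/(window (t - n) w i) -/V -/(outer V i).
    by rewrite mulmxBr addrAC.
  rewrite !big_split/=; congr (_ + _).
  under eq_bigr => i _.
    rewrite {2}tE (@beta_diff T (t - n) N i n w s0 (ltn_ord i)); last by rewrite /N; lia.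
    rewrite -/kap -scalemxAr mulmx_sumr; over.
  (* Summing over observation times i first collects the coefficient of each u_k. *)
  rewrite -scaler_sumr exchange_big/= scaler_sumr; apply: eq_bigr => k _.
  rewrite /drift mulmx_suml; congr (_ *: _); apply: eq_bigr => i _.
  by rewrite -scalemxAr scalemxAl.
rewrite mulmx_sumr; apply: eq_bigr => k _.
rewrite big_option/= mulmxDr addrC -!scalemxAr /error_coef -SE; congr (_ + _).
rewrite mulmxA; set A := invmx S *m _.
apply/matrixP => a b; rewrite ord1 !mxE summxE mulr_sumr; apply: eq_bigr => c _.
by rewrite !mxE; ring.
Qed.

End WindowRewriting.

(** * Means of real random variables *)

Section RealMean.
Context {d : measure_display} {W : measurableType d} {R : realType}.
Variable P : probability W R.
Implicit Types (f g : W -> R) (a b c : R).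

Definition has_mean f a :=
  P.-integrable setT (EFin \o f) /\ (\int[P]_w (f w)%:E)%E = a%:E.

Lemma has_mean_cst c : has_mean (fun _ => c) c.
Proof.
split; last exact: integral_cst1.
by apply: (@finite_measure_integrable_cst _ _ _ _ setT c).
Qed.

Lemma has_meanD f g a b : has_mean f a -> has_mean g b ->
  has_mean (fun w => f w + g w) (a + b).
Proof.
move=> [fi fa] [gi gb]; split; first exact: (integrableD measurableT fi gi).
by rewrite (integralD measurableT fi gi) EFinD -fa -gb.
Qed.

Lemma has_meanZ c f a : has_mean f a -> has_mean (fun w => c * f w) (c * a).
Proof.
move=> [fi fa]; split; first exact: (integrableZl measurableT c fi).
by rewrite (integralZl measurableT fi) EFinM -fa.
Qed.

Lemma has_mean_sum (I : Type) (s : seq I) (f : I -> W -> R) (a : I -> R) :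
  (forall i, has_mean (f i) (a i)) ->
  has_mean (fun w => \sum_(i <- s) f i w) (\sum_(i <- s) a i).
Proof.
move=> fa; elim: s => [|i s IH].
  by under eq_fun do rewrite big_nil; rewrite big_nil; exact: has_mean_cst.
by under eq_fun do rewrite big_cons; rewrite big_cons; exact: has_meanD.
Qed.

Lemma has_mean_integrable f :
  P.-integrable setT (EFin \o f) -> exists a, has_mean f a.
Proof.
move=> fi; exists (fine (\int[P]_w (f w)%:E)%E); split => //.
by rewrite fineK//; exact: (integrable_fin_num measurableT fi).
Qed.

(* The mean of the product is read off that of the square of the sum: the
   latter is nonnegative, so that Tonelli's theorem suffices. *)
Lemma independent_cross_mean (X Y : W -> R) a b :
  measurable_fun setT X -> measurable_fun setT Y ->
  independent P (fun _ : unit => X) (fun _ : unit => Y) ->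
  has_mean X 0 -> has_mean Y 0 ->
  has_mean (fun w => X w ^+ 2) a -> has_mean (fun w => Y w ^+ 2) b ->
  P.-integrable setT (EFin \o (fun w => X w * Y w)) ->
  has_mean (fun w => X w * Y w) 0.
Proof.
move=> mX mY XY X0 Y0 Xa Yb /has_mean_integrable[e XYe].
have sq : has_mean (fun w => (X w + Y w) ^+ 2) (a + (2 * e + b)).
  rewrite (_ : (fun w => _) =
      fun w => X w ^+ 2 + (2 * (X w * Y w) + Y w ^+ 2)).
    by do 2!apply: has_meanD => //; exact: has_meanZ.
  by apply/funext => w; ring.
pose g (z : @pathspace R unit * @pathspace R unit) : \bar R :=
  ((z.1 tt + z.2 tt) ^+ 2)%:E.
have mg : measurable_fun setT g.
  apply/measurable_EFinP; apply: measurable_funX; apply: measurable_funD.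
    by apply: (measurableT_comp (measurable_coordinate tt)).
  by apply: (measurableT_comp (measurable_coordinate tt)).
have := @independent_integral R _ _ P unit unit (fun=> X) (fun=> Y) g
  (fun=> mX) (fun=> mY) XY mg (fun z => sqr_ge0 _).
rewrite /g /= sq.2.
(* With X frozen, the cross term integrates to zero because Y has mean zero; comparing a + b with a
   + 2 e + b gives e = 0. *)
under eq_integral => w1 _.
  rewrite (_ : (fun w2 => _) = (fun w2 =>
     (X w1 ^+ 2 + (2 * X w1 * Y w2 + Y w2 ^+ 2))%:E)); last first.
    by apply/funext => w2; congr (_%:E); ring.
  rewrite (has_meanD (has_mean_cst (X w1 ^+ 2))
    (has_meanD (has_meanZ (2 * X w1) Y0) Yb)).2 mulr0 add0r; over.
rewrite (has_meanD Xa (has_mean_cst b)).2 => -[] h.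
by have -> : 0 = e by lra.
Qed.

End RealMean.

(** * Second moments of the noise *)

Section Noise.
Context {d : measure_display} {W : measurableType d} {R : realType}.
Variables (P : probability W R) (p : nat).
Variables (x u : nat -> 'I_p -> {RV P >-> R}) (eps : nat -> {RV P >-> R}).
Variables (sigma_eps sigma_u : R).
Hypothesis b : cond_b x u eps sigma_eps sigma_u.

Let eta := eps_u u eps.

Definition noise_var (o : option 'I_p) : R :=
  if o is Some _ then sigma_u ^+ 2 else sigma_eps ^+ 2.

Lemma measurable_noise k o : measurable_fun setT (eta k o).
Proof. by case: o => [i|] /=; exact: measurable_funPT. Qed.

Lemma noise_product_integrable k l o o' : (0 < k)%N -> (0 < l)%N ->
  P.-integrable setT (EFin \o (fun w => eta k o w * eta l o' w)).
Proof.
have [_ _ b3 _ _] := b => k0 l0.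
have [h1 _] := b3 k o k0; have [h2 _] := b3 l o' l0.
by have /Lfun1_integrable := Lfun2_mul_Lfun1 h1 h2.
Qed.

Lemma noise_mean k o : (0 < k)%N -> has_mean P (eta k o) 0.
Proof.
have [_ _ b3 _ _] := b => k0; have [h1 h2] := b3 k o k0.
have h1' : eta k o \in Lfun P 1.
  by apply: Lfun_subset12 => //; exact: fin_num_measure.
split; first exact/Lfun1_integrable.
by move: h2; rewrite expectation.unlock.
Qed.

Lemma noise_same_time k o o' : (0 < k)%N ->
  has_mean P (fun w => eta k o w * eta k o' w)
             (if o == o' then noise_var o else 0).
Proof.
move=> k0; have [_ _ b3 b4 _] := b.
have [ce cu cuu] := b4 k k0.
have H q q' c : covariance P (eta k q) (eta k q') = c%:E ->
    has_mean P (fun w => eta k q w * eta k q' w) c.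
  move=> cE; split; first exact: noise_product_integrable.
  rewrite -cE covariance.unlock (b3 k q k0).2 (b3 k q' k0).2 expectation.unlock.
  by apply: eq_integral => w _; rewrite [in RHS]/GRing.mul /= /cst /= !subr0.
case: o o' => [i|] [j|].
- have := cuu i j; rewrite -[i == j]/(Some i == Some j).
  by case: ifP => ij cij; exact: H.
- rewrite (_ : (fun w => _) = fun w => eta k None w * eta k (Some i) w).
    exact: (H None (Some i) 0 (cu i)).
  by apply/funext => w; rewrite mulrC.
- exact: (H None (Some j) 0 (cu j)).
- exact: H.
Qed.

Lemma noise_independent k l o o' : k != l ->
  independent P (fun _ : unit => eta k.+1 o) (fun _ : unit => eta l.+1 o').
Proof.
have [[b1 _] _ _ _ _] := b => kl A B mA mB.
(* An event about one component is a cylinder event about the whole noise vector. *)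
have cyl q (C : set (unit -> R)) : product_sigma C ->
    product_sigma [set f : option 'I_p -> R | C (fun=> f q)].
  move=> mC.
  have := @measurable_path R _ (@pathspace R (option 'I_p)) unit
    (fun=> fun f => f q) (fun=> measurable_coordinate q) measurableT C mC.
  by rewrite setTI.
(* Mutual independence is applied to the times k and l only, so [D] is read at these two. *)
pose D j := if j == k then [set f : option 'I_p -> R | A (fun=> f o)]
            else [set f : option 'I_p -> R | B (fun=> f o')].
have := b1 [:: k; l] D.
rewrite /= inE kl => /(_ isT) h.
have {}h := h (fun j => _ : product_sigma (D j)).
have mD j : product_sigma (D j) by rewrite /D; case: ifP => _; exact: cyl.
move: (h mD); rewrite !big_cons big_nil mule1 {2 3}/D eqxx eq_sym (negPf kl).
have -> : \bigcap_(j in [set` [:: k; l]]) event (eta j.+1) (D j) =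
    event (fun _ : unit => eta k.+1 o) A `&`
    event (fun _ : unit => eta l.+1 o') B; last by [].
apply/seteqP; split => w.
  move=> H; split.
    by have := H k; rewrite /= inE eqxx /event/= /D eqxx; exact.
  have := H l; rewrite /= !inE eqxx orbT /event/= /D eq_sym (negPf kl); exact.
move=> [HA HB] j; rewrite /= !inE => /orP[/eqP->|/eqP->].
  by rewrite /event/= /D eqxx.
by rewrite /event/= /D eq_sym (negPf kl).
Qed.

(** At equal times this is the covariance of (b); at distinct times, independence with zero
    means. *)
Lemma noise_cross k l o o' : (0 < k)%N -> (0 < l)%N ->
  has_mean P (fun w => eta k o w * eta l o' w)
             (if (k, o) == (l, o') then noise_var o else 0).
Proof.
move=> k0 l0; rewrite xpair_eqE; have [<-|kl] := eqVneq k l.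
  exact: noise_same_time.
have sq j q : (0 < j)%N -> has_mean P (fun w => eta j q w ^+ 2) (noise_var q).
  by move=> j0; have := noise_same_time q q j0; rewrite eqxx.
apply: (@independent_cross_mean _ _ _ P _ _ (noise_var o) (noise_var o'));
  rewrite -?expr2; try exact: measurable_noise.
- by rewrite -(prednK k0) -(prednK l0); apply: noise_independent; lia.
- exact: noise_mean.
- exact: noise_mean.
- exact: sq.
- exact: sq.
- exact: noise_product_integrable.
Qed.

(** Orthogonality leaves only the diagonal of the expanded square. The constants [c] stand for
    coefficients with the regressors held fixed. *)
Lemma noise_energy s N (c : 'I_N -> option 'I_p -> R) : (0 < s)%N ->
  (\int[P]_w ((\sum_(k < N) \sum_(o : option 'I_p) eta (s + k) o w * c k o) ^+ 2)%:E)%E =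
  (\sum_(k < N) \sum_(o : option 'I_p) c k o ^+ 2 * noise_var o)%:E.
Proof.
move=> s0.
have : has_mean P (fun w => \sum_(q : 'I_N * option 'I_p)
    \sum_(q' : 'I_N * option 'I_p) c q.1 q.2 * c q'.1 q'.2 *
      (eta (s + q.1) q.2 w * eta (s + q'.1) q'.2 w))
   (\sum_(q : 'I_N * option 'I_p) \sum_(q' : 'I_N * option 'I_p)
      c q.1 q.2 * c q'.1 q'.2 * (if (s + q.1, q.2)%N == (s + q'.1, q'.2)%N
      then noise_var q.2 else 0)).
  apply: has_mean_sum => q; apply: has_mean_sum => q'; apply: has_meanZ.
  by apply: noise_cross; rewrite addn_gt0 s0.
case=> _ h.
transitivity (\sum_(q : 'I_N * option 'I_p) \sum_(q' : 'I_N * option 'I_p)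
      c q.1 q.2 * c q'.1 q'.2 * (if (s + q.1, q.2)%N == (s + q'.1, q'.2)%N
      then noise_var q.2 else 0))%:E.
  rewrite -h; apply: eq_integral => w _; congr (_%:E).
  rewrite pair_bigA/= expr2 mulr_suml; apply: eq_bigr => q _.
  by rewrite mulr_sumr; apply: eq_bigr => q' _; ring.
congr (_%:E); rewrite [RHS]pair_bigA/=; apply: eq_bigr => q _.
rewrite (bigD1 q)//= eqxx expr2 big1 ?addr0// => q' q'q.
rewrite (_ : (_ == _) = false) ?mulr0//; apply/negP.
rewrite xpair_eqE eqn_add2l => /andP[/eqP e1 /eqP e2].
move/eqP: q'q; apply; case: q q' e1 e2 {h} => [q1 q2] [q1' q2'] /= e1 e2.
by congr (_, _) => //; exact/esym/val_inj.
Qed.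

End Noise.

(** * Measurability of window functionals *)

Section WindowMeasurability.
Context {d : measure_display} {E : measurableType d} {R : realType} {p : nat}.
Variable V : E -> nat -> 'cV[R]_p.
Hypothesis mV : forall i, mx_measurable (fun e => V e i).

Lemma mx_measurable_outer i : mx_measurable (fun e => outer (V e) i).
Proof. by apply: mx_measurableM => //; exact: mx_measurable_tr. Qed.

Lemma mx_measurable_psum n : mx_measurable (fun e => psum (outer (V e)) n).
Proof. by apply: mx_measurable_sum => i; exact: mx_measurable_outer. Qed.

Lemma mx_measurable_lower n : mx_measurable (fun e => lower_gram (outer (V e)) n).
Proof.
by apply: mx_measurable_sum => i; apply: mx_measurableM;
  exact: mx_measurable_psum.
Qed.

Lemma mx_measurable_upper n : mx_measurable (fun e => upper_gram (outer (V e)) n).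
Proof.
by apply: mx_measurable_sum => i; apply: mx_measurableM;
  apply: mx_measurableB; exact: mx_measurable_psum.
Qed.

Lemma measurable_trace n (A : E -> 'M[R]_n) : mx_measurable A ->
  measurable_fun setT (fun e => \tr (A e)).
Proof. by move=> mA; apply: measurable_sum => i; exact: mA. Qed.

Lemma mx_measurable_error_coef kappa n N k o :
  mx_measurable (fun e => error_coef kappa n N (V e) k o).
Proof.
have mS : mx_measurable (fun e => invmx (psum (outer (V e)) N)).
  exact/mx_measurable_invmx/mx_measurable_psum.
case: o => [b|]; rewrite /error_coef; last exact: mx_measurableM.
apply: mx_measurableZ => // i j; under eq_fun do rewrite mxE.
apply: mx_measurableM => //; apply: mx_measurable_sum => l.
by apply: mx_measurableZ => //; exact: mx_measurable_outer.
Qed.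

End WindowMeasurability.

(** * The mean squared error as a mean over the regressors *)

Section MeanSquaredError.
Context {d : measure_display} {W : measurableType d} {R : realType}.
Variables (P : probability W R) (p : nat).
Variables (x u : nat -> 'I_p -> {RV P >-> R}) (eps : nat -> {RV P >-> R}).
Variables (sigma_eps sigma_u : R).
Hypothesis b : cond_b x u eps sigma_eps sigma_u.

Lemma independent_sym (I J : Type) (X : I -> W -> R) (Y : J -> W -> R) :
  independent P X Y -> independent P Y X.
Proof. by move=> XY A B mA mB; rewrite setIC XY// muleC. Qed.

Lemma mx_measurable_vec (v : nat -> 'I_p -> {RV P >-> R}) i :
  mx_measurable (vec v i).
Proof.
by move=> a c; under eq_fun do rewrite mxE; exact: measurable_funPT.
Qed.

Lemma mx_measurable_estimation_error T n t :
  mx_measurable (fun w => beta_hat x u eps T n t w - beta u T t w).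
Proof.
have mbeta i : mx_measurable (beta u T i).
  by apply: mx_measurableZ => //; apply: mx_measurable_sum => k;
     exact: mx_measurable_vec.
apply: mx_measurableB => //; apply: mx_measurableM.
  apply: mx_measurable_invmx; apply: mx_measurable_sum => i.
  apply: mx_measurableM; first exact: mx_measurable_vec.
  by apply: mx_measurable_tr; exact: mx_measurable_vec.
apply: mx_measurable_sum => i; apply: mx_measurableZ; last exact: mx_measurable_vec.
apply: measurable_funD; last exact: measurable_funPT.
apply: (mx_measurableM (mx_measurable_tr (@mx_measurable_vec x i)) (mbeta i)).
Qed.

Lemma enorm_sqr (v : 'cV[R]_p) : enorm v ^+ 2 = \sum_a v a 0 ^+ 2.
Proof.
have E : (v^T *m v) 0 0 = \sum_a v a 0 ^+ 2.
  by rewrite mxE; apply: eq_bigr => a _; rewrite mxE expr2.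
by rewrite /enorm sqr_sqrtr E// sumr_ge0// => a _; rewrite sqr_ge0.
Qed.

(** Coordinate k of a path carries time k + 1, whence the shift by one in [window_pathE]. *)
Definition path_window s (f : @pathspace R (nat * 'I_p)) : nat -> 'cV[R]_p :=
  fun i => \col_j f ((s + i)%N, j).

Lemma mx_measurable_path_window s i :
  mx_measurable (fun f => path_window s f i).
Proof.
move=> a c.
have <- : (fun f : @pathspace R (nat * 'I_p) => f ((s + i)%N, a)) =
    (fun f => path_window s f i a c) by apply/funext => f; rewrite mxE.
exact: measurable_coordinate.
Qed.

Lemma window_pathE s w :
  window x s.+1 w = path_window s ((process (fun k i => x k.+1 i : W -> R))^~ w).
Proof. by apply/funext => i; apply/matrixP => a c; rewrite !mxE. Qed.

(** By independence and Tonelli the noise can be integrated first, along a frozen path of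
    regressors; [noise_energy] evaluates the inner integral. *)
Lemma MSE_conditional T n t : (n < t)%N ->
  {ae P, forall w, window_sum x n t w \in unitmx} ->
  MSE x u eps T n t = (\int[P]_w (\sum_a \sum_(k < (n + n).+1) \sum_o
    error_coef (Num.sqrt T%:R)^-1 n (n + n).+1 (window x (t - n) w) k o a 0
      ^+ 2 * noise_var sigma_eps sigma_u o)%:E)%E.
Proof.
move=> nt uS; set N := (n + n).+1; set kap := (Num.sqrt T%:R)^-1.
have [s ts] : exists s, (t - n = s.+1)%N by exists (t - n).-1; lia.
have [_ bi _ _ _] := b.
pose err (z : @pathspace R (nat * 'I_p) * @pathspace R (nat * option 'I_p)) a :=
  \sum_(k < N) \sum_o z.2 ((s + k)%N, o) *
     error_coef kap n N (path_window s z.1) k o a 0.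
pose g z : \bar R := (\sum_a err z a ^+ 2)%:E.
have merr a : measurable_fun setT (err ^~ a).
  apply: measurable_sum => k; apply: measurable_sum => o.
  apply: measurable_funM.
    by apply: (measurableT_comp (measurable_coordinate _)).
  have := @mx_measurable_error_coef _ _ _ _ _ (mx_measurable_path_window s)
    kap n N k o a 0.
  by move/measurableT_comp; apply.
have mg : measurable_fun setT g.
  by apply/measurable_EFinP; apply: measurable_sum => a; exact: measurable_funX.
pose Xp := process (fun k i => x k.+1 i : W -> R).
pose Np := process (fun k => eps_u u eps k.+1).
have mXp i : measurable_fun setT (Xp i) by exact: measurable_funPT.
have mNp i : measurable_fun setT (Np i) by exact: measurable_noise.
transitivity (\int[P]_w g (Xp ^~ w, Np ^~ w))%E.
  rewrite /MSE expectation.unlock; apply: ge0_ae_eq_integral => //.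
  - apply/measurable_EFinP; under eq_fun do rewrite enorm_sqr.
    apply: measurable_sum => a; apply: measurable_funX.
    exact: mx_measurable_estimation_error.
  - apply: (measurableT_comp mg).
    by apply: measurable_fun_pair; exact: measurable_path.
  - by move=> w _; rewrite lee_fin sqr_ge0.
  - by move=> w _; rewrite lee_fin sumr_ge0// => a _; exact: sqr_ge0.
  apply: filterS uS => w uw _; congr (_%:E); rewrite enorm_sqr.
  apply: eq_bigr => a _; congr (_ ^+ 2).
  rewrite estimation_errorE// ts summxE; apply: eq_bigr => k _.
  rewrite summxE; apply: eq_bigr => o _.
  by rewrite mxE window_pathE.
rewrite independent_integral//; last 2 first.
- exact: independent_sym.
- by move=> z; rewrite lee_fin sumr_ge0// => a _; exact: sqr_ge0.
apply: eq_integral => w1 _.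
under eq_integral do rewrite /g -sumEFin.
rewrite ge0_integral_sum//; last 2 first.
- move=> a; apply/measurable_EFinP; apply: measurable_funX.
  apply: measurable_sum => k; apply: measurable_sum => o.
  by apply: measurable_funM => /=.
- by move=> a w _; rewrite lee_fin sqr_ge0.
rewrite -sumEFin; apply: eq_bigr => a _.
rewrite ts window_pathE.
have := noise_energy b (fun (k : 'I_N) o =>
  error_coef kap n N (path_window s (Xp ^~ w1)) k o a 0) (ltn0Sn s).
by move=> <-.
Qed.

End MeanSquaredError.

(** * Domination of window averages by traces *)

Section WindowBounds.
Context {R : realType} {p : nat}.
Implicit Types (V : nat -> 'cV[R]_p) (n k : nat).

Lemma trace_Lam n V : \tr (Lam n V) = n%:R^-1 * \tr (psum (outer V) n).
Proof. by rewrite /Lam linearZ. Qed.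

Lemma psum_trace_le V m n : (m <= n)%N ->
  \tr (psum (outer V) m) <= \tr (psum (outer V) n).
Proof.
move=> mn; rewrite /psum !raddf_sum/=.
rewrite (big_ord_widen n (fun i => \tr (outer V i)) mn) big_mkcond/=.
by apply: ler_sum => i _; case: ifP => // _; exact: outer_tr_ge0.
Qed.

(** The sum may stop before n, as the inner sums of [Xih] do. *)
Lemma weighted_mean_entry_le V m n (c : nat -> R) a b : (m <= n)%N ->
  (forall i, (i < m)%N -> `|c i| <= 1) ->
  `|(n%:R^-1 *: \sum_(i < m) c i *: outer V i) a b| <= \tr (Lam n V).
Proof.
move=> mn c1; rewrite mxE normrM ger0_norm ?invr_ge0// trace_Lam.
rewrite ler_wpM2l ?invr_ge0//; apply: le_trans (psum_trace_le V mn).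
exact: weighted_outer_entry_le.
Qed.

Lemma ratio_le1 m n : (m <= n)%N -> `|m%:R / n%:R : R| <= 1.
Proof.
move=> mn; rewrite ger0_norm ?divr_ge0//.
have [->|n0] := eqVneq n 0%N; first by rewrite invr0 mulr0.
by rewrite ler_pdivrMr ?ltr0n ?lt0n// mul1r ler_nat.
Qed.

Lemma Lbar_entry_le n V a b : `|Lbar n V a b| <= \tr (Lam n V).
Proof.
apply: (@weighted_mean_entry_le V n n (fun j => (n - j)%:R / n%:R)) => // i i_n.
by apply: ratio_le1; lia.
Qed.

Lemma Xih_entry_le n V a b :
  `|Xih n V a b| <= p%:R * (\tr (Lam n V) * \tr (Lam n V)).
Proof.
rewrite mxE normrM ger0_norm ?invr_ge0// summxE.
apply: (@le_trans _ _ (n%:R^-1 * \sum_(i < n)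
    (\tr (outer V i) * (p%:R * \tr (Lam n V))))).
  rewrite ler_wpM2l ?invr_ge0//; apply: (le_trans (ler_norm_sum _ _ _)).
  apply: ler_sum => i _; rewrite mxE; apply: (le_trans (ler_norm_sum _ _ _)).
  apply: (@le_trans _ _ (\sum_(j < p) (\tr (outer V i) * \tr (Lam n V)))).
    apply: ler_sum => j _; rewrite normrM; apply: ler_pM => //.
      exact: outer_entry_le.
    apply: (@weighted_mean_entry_le V i.+1 n (fun j => (i - j)%:R / n%:R)) => //.
    by move=> k ki; apply: ratio_le1; have := ltn_ord i; lia.
  by rewrite sumr_const card_ord -mulr_natl; lra.
have E : \sum_(i < n) \tr (outer V i) = \tr (psum (outer V) n).
  by rewrite /psum raddf_sum.
rewrite -mulr_suml E [leLHS](_ : _ = p%:R * (\tr (Lam n V) * \tr (Lam n V)))//.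
by rewrite {2}trace_Lam; ring.
Qed.

(** The 2n + 1 times are two blocks of length n around a middle one, and the middle term is bounded
    by the block of length n that starts with it. *)
Lemma mean_window_entry_le n V a b : (0 < n)%N ->
  `|((2 * n%:R)^-1 *: psum (outer V) (n + n).+1) a b| <=
  \tr (Lam n V) + \tr (Lam n (fun i => V (n + i)%N)) +
  \tr (Lam n (fun i => V (n.+1 + i)%N)).
Proof.
move=> n0; have n0' : 0 < n%:R :> R by rewrite ltr0n.
rewrite mxE normrM ger0_norm ?invr_ge0 ?mulr_ge0//.
have h : `|psum (outer V) (n + n).+1 a b| <= \tr (psum (outer V) (n + n).+1).
  rewrite /psum summxE raddf_sum/=; apply: (le_trans (ler_norm_sum _ _ _)).
  by apply: ler_sum => i _; exact: outer_entry_le.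
have E : \tr (psum (outer V) (n + n).+1) <= \tr (psum (outer V) n) +
    \tr (psum (outer (fun i => V (n + i)%N)) n) +
    \tr (psum (outer (fun i => V (n.+1 + i)%N)) n).
  rewrite -[(n + n).+1]addSn {1}/psum big_split_ord/= big_ord_recr/=.
  rewrite -/(psum (outer V) n) !raddfD/= -!addrA lerD2l.
  rewrite -[X in _ + X](_ : \tr (psum (outer (fun i => V (n.+1 + i)%N)) n) = _)//.
  rewrite lerD2r; case: n n0 {n0' h} => // n _.
  rewrite /psum big_ord_recl/= raddfD/= /outer addn0 lerDl raddf_sum.
  apply: sumr_ge0 => i _; exact: outer_tr_ge0.
have n2 : (2 * n%:R)^-1 = 2^-1 * n%:R^-1 :> R by rewrite invfM.
rewrite n2 !trace_Lam -!mulrDr -mulrA.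
set x := \tr _ + _ + _ in E *.
have x0 : 0 <= n%:R^-1 * x.
  rewrite mulr_ge0 ?invr_ge0// (le_trans _ E)//.
  by rewrite (le_trans _ h).
have : n%:R^-1 * `|psum (outer V) (n + n).+1 a b| <= n%:R^-1 * x.
  by rewrite ler_wpM2l ?invr_ge0// (le_trans h).
lra.
Qed.

End WindowBounds.

(** * Invariance of window moments in time *)

Section Stationarity.
Context {d : measure_display} {W : measurableType d} {R : realType}.
Variables (P : probability W R) (p : nat).
Variable x : nat -> 'I_p -> {RV P >-> R}.
Hypothesis a : cond_a x.

(** A window starting at s + 1 is the initial window of the path shifted by s, which has the same
    law. *)
Lemma stationary_moment k (F : (nat -> 'cV[R]_p) -> R) s :
  measurable_fun setT (fun f => F (path_window 0 f)) ->
  moment P k (fun w => F (window x s.+1 w)) =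
  moment P k (fun w => F (window x 1 w)).
Proof.
move=> mF; have [st _ _] := a.
pose X k i : W -> R := x k.+1 i.
have E j : (fun w => (`|F (window x j.+1 w)| ^+ k)%:E) =
    (fun w => (`|F (path_window 0 ((process (fun k i => X (k + j)%N i))^~ w))|
       ^+ k)%:E).
  apply/funext => w; congr (`|F _| ^+ _)%:E; apply/funext => i.
  by apply/matrixP => c e; rewrite !mxE /process/= /X add0n addSn addnC.
rewrite /moment (E s) (E 0%N); apply/esym.
pose g (f : @pathspace R (nat * 'I_p)) : \bar R :=
  (`|F (path_window 0 f)| ^+ k)%:E.
apply: (@same_law_integral R _ _ P _ _ _ g).
- by move=> i; exact: measurable_funPT.
- by move=> i; exact: measurable_funPT.
- have -> : (fun k i => X (k + 0)%N i) = X.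
    by apply/funext => j; rewrite addn0.
  exact: st.
- by apply/measurable_EFinP; exact: measurable_normX.
- by move=> f; rewrite lee_fin exprn_ge0.
Qed.

Lemma stationary_moment_eq k (F : (nat -> 'cV[R]_p) -> R) s s' :
  (0 < s)%N -> (0 < s')%N ->
  measurable_fun setT (fun f => F (path_window 0 f)) ->
  moment P k (fun w => F (window x s w)) =
  moment P k (fun w => F (window x s' w)).
Proof.
case: s => [//|s] _; case: s' => [//|s'] _ mF.
by rewrite (stationary_moment _ s mF) (stationary_moment _ s' mF).
Qed.

End Stationarity.

(** * Bounded moments of the averages *)

Section WindowMoments.
Context {d : measure_display} {W : measurableType d} {R : realType}.
Variables (P : probability W R) (p : nat).
Variable x : nat -> 'I_p -> {RV P >-> R}.
Variables n t : nat -> nat.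
Hypothesis a : cond_a x.
Hypothesis d' : cond_d x n t.
Hypothesis n_gt0 : \forall T \near \oo, (0 < n T)%N.
Hypothesis n_lt_t : \forall T \near \oo, (n T < t T)%N.

(** The word repeating the letter i 2^k times gives the power 2^k of the factor, whose first moments
    are bounded by (d). *)
Lemma mx_bounded_factor i :
  (forall T, mx_measurable (fun w => tnth (factors x (n T) (t T) w) i)) ->
  (forall T w, (tnth (factors x (n T) (t T) w) i)^T =
     tnth (factors x (n T) (t T) w) i) ->
  mx_bounded P (fun T w => tnth (factors x (n T) (t T) w) i).
Proof.
move=> mM sM; apply: mx_bounded_sym => // k b c.
have [_ /(_ (nseq (2 ^ k) i)) [T0 ui]] := d'.
have [C hC] := uniformly_integrable_moment1 (ui b c).
exists C; near=> T.
have -> : (fun w => mx_sqiter k (tnth (factors x (n T) (t T) w) i) b c) =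
    (fun w => factor_product x (nseq (2 ^ k) i) (n T) (t T) w b c).
  apply/funext => w; congr (fun_of_matrix _ b c).
  rewrite mx_sqiter_nseq /factor_product.
  by elim: (2 ^ k)%N => [|m IH]; rewrite ?big_nil//= !big_cons IH.
by apply: hC; near: T; exists T0.
Unshelve. all: by end_near. Qed.

Lemma mx_measurable_xx i : mx_measurable (xx x i).
Proof.
apply: mx_measurableM; first exact: mx_measurable_vec.
by apply: mx_measurable_tr; exact: mx_measurable_vec.
Qed.

Lemma xx_sym i w : (xx x i w)^T = xx x i w.
Proof. by rewrite /xx trmx_mul trmxK. Qed.

Lemma window_sum_sym m s w : (window_sum x m s w)^T = window_sum x m s w.
Proof.
by rewrite /window_sum raddf_sum; apply: eq_bigr => i _; exact: xx_sym.
Qed.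

Lemma mx_measurable_Omega_hat m s : mx_measurable (Omega_hat x m s).
Proof.
by apply: mx_measurableZ => //; apply: mx_measurable_sum => i;
  exact: mx_measurable_xx.
Qed.

Lemma mx_bounded_inv_Omega_hat :
  mx_bounded P (fun T w => invmx (Omega_hat x (n T) (t T) w)).
Proof.
apply: (@mx_bounded_factor 0) => [T|T w].
  exact/mx_measurable_invmx/mx_measurable_Omega_hat.
by rewrite /= [tnth _ _]/(invmx _) trmx_inv /Omega_hat linearZ/= window_sum_sym.
Qed.

Lemma mx_bounded_Lambda_hat :
  mx_bounded P (fun T w => Lambda_hat x (n T) (t T) w).
Proof.
apply: (@mx_bounded_factor 1) => [T|T w].
  by apply: mx_measurableZ => //; apply: mx_measurable_sum => i;
    exact: mx_measurable_xx.
rewrite /= [tnth _ _]/(Lambda_hat _ _ _ _) /Lambda_hat linearZ/= raddf_sum.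
by congr (_ *: _); apply: eq_bigr => i _; exact: xx_sym.
Qed.

(** Stationarity carries the bound from the window of [Lambda_hat] to a window starting anywhere. *)
Lemma moments_bounded_trace_Lam (s : nat -> nat) :
  (\forall T \near \oo, (0 < s T)%N) ->
  moments_bounded P (fun T w => \tr (Lam (n T) (window x (s T) w))).
Proof.
move=> s0.
have mLam (s' : nat) T :
    measurable_fun setT (fun w => \tr (Lam (n T) (window x s' w))).
  apply: measurable_trace; apply: mx_measurableZ => //.
  by apply: mx_measurable_psum => i; exact: mx_measurable_vec.
split => // k.
have [_ /(_ k) [C hC]] := moments_bounded_trace mx_bounded_Lambda_hat.
exists C; near=> T; have nt : (n T < t T)%N by near: T.
have sT : (0 < s T)%N by near: T.
have mF : measurable_fun setT
    (fun f : @pathspace R (nat * 'I_p) => \tr (Lam (n T) (path_window 0 f))).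
  apply: measurable_trace; apply: mx_measurableZ => //.
  by apply: mx_measurable_psum => i; exact: mx_measurable_path_window.
have s0' : (0 < t T - n T)%N by rewrite subn_gt0.
have := stationary_moment_eq a k sT s0' (F := fun V => \tr (Lam (n T) V)).
move=> /(_ mF) ->.
have -> : (fun w => \tr (Lam (n T) (window x (t T - n T) w))) =
    (fun w => \tr (Lambda_hat x (n T) (t T) w)).
  by apply/funext => w; rewrite Lambda_hatE.
by near: T.
Unshelve. all: by end_near. Qed.

Lemma mx_bounded_Lambda_bar_hat :
  mx_bounded P (fun T w => Lambda_bar_hat x (n T) (t T) w).
Proof.
move=> b c.
apply: (moments_bounded_dominated _ (@moments_bounded_trace_Lam
  (fun T => t T - n T)%N _)).
- move=> T; apply: mx_measurableZ => //; apply: mx_measurable_sum => i.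
  by apply: mx_measurableZ => //; exact: mx_measurable_xx.
- by apply: filterS n_lt_t => T; rewrite subn_gt0.
near=> T => w; rewrite Lambda_bar_hatE; last by near: T.
by apply: (le_trans (Lbar_entry_le _ _ _ _)); exact: ler_norm.
Unshelve. all: by end_near. Qed.

Lemma mx_bounded_Xi_hat :
  mx_bounded P (fun T w => Xi_hat x (n T) (t T) w).
Proof.
move=> b c.
have bt : moments_bounded P
    (fun T w => \tr (Lam (n T) (window x (t T - n T) w))).
  by apply: moments_bounded_trace_Lam; apply: filterS n_lt_t => T;
     rewrite subn_gt0.
apply: (moments_bounded_dominated _ (moments_boundedM
  (moments_bounded_cst P p%:R) (moments_boundedM bt bt))).
- move=> T; apply: mx_measurableZ => //; apply: mx_measurable_sum => i.
  apply: mx_measurableM; first exact: mx_measurable_xx.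
  apply: mx_measurableZ => //; apply: mx_measurable_sum => j.
  by apply: mx_measurableZ => //; exact: mx_measurable_xx.
near=> T => w; rewrite Xi_hatE; last by near: T.
by apply: (le_trans (Xih_entry_le _ _ _ _)); exact: ler_norm.
Unshelve. all: by end_near. Qed.

Lemma mx_bounded_Omega_hat :
  mx_bounded P (fun T w => Omega_hat x (n T) (t T) w).
Proof.
move=> b c.
have bt (s : nat -> nat) : (forall T, (t T - n T <= s T)%N) -> moments_bounded P
    (fun T w => \tr (Lam (n T) (window x (s T) w))).
  move=> sT; apply: moments_bounded_trace_Lam; apply: filterS n_lt_t => T nt.
  by apply: leq_trans (sT T); rewrite subn_gt0.
apply: (moments_bounded_dominated _ (moments_boundedD (moments_boundedD
  (bt (fun T => t T - n T)%N (fun=> leqnn _))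
  (bt (fun T => t T - n T + n T)%N (fun=> leq_addr _ _)))
  (bt (fun T => t T - n T + (n T).+1)%N (fun=> leq_addr _ _)))).
- by move=> T; exact: mx_measurable_Omega_hat.
near=> T => w; rewrite /Omega_hat window_sumE; last by near: T.
have nT : (0 < n T)%N by near: T.
apply: (le_trans (mean_window_entry_le _ _ _ nT)).
apply: le_trans (ler_norm _).
have E m : (fun i => window x (t T - n T) w (m + i)%N) =
    window x (t T - n T + m) w.
  by apply/funext => i; rewrite /window addnA.
by rewrite -(E (n T)) -(E (n T).+1).
Unshelve. all: by end_near. Qed.

End WindowMoments.

(** * Linear growth of subadditive sequences *)

Section Subadditive.
Context {R : realType}.

(** Write m = q k + r with r < k: the q blocks cost at most m e, the r single steps at most k C. *)
Lemma subadditive_linear_bound (f : nat -> \bar R) (e C : R) k :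
  (forall m l, f (m + l)%N <= f m + f l)%E -> f 0%N = 0%E ->
  0 <= e -> 0 <= C -> (0 < k)%N ->
  (f k <= (k%:R * e)%:E)%E -> (f 1%N <= C%:E)%E ->
  forall m, (f m <= (m%:R * e + k%:R * C)%:E)%E.
Proof.
move=> sub f0 e0 C0 k0 fk f1 m.
have H q l D : (f l <= D%:E)%E -> (f (q * l)%N <= (q%:R * D)%:E)%E.
  move=> fl; elim: q => [|q IH]; first by rewrite mul0n f0 mul0r.
  rewrite mulSn -nat1r mulrDl mul1r EFinD.
  by apply: (le_trans (sub _ _)); apply: leeD.
rewrite {1}(divn_eq m k); apply: (le_trans (sub _ _)); rewrite EFinD.
apply: leeD.
  apply: (le_trans (H (m %/ k)%N _ _ fk)); rewrite lee_fin mulrA.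
  by rewrite ler_wpM2r// -natrM ler_nat leq_trunc_div.
rewrite -{1}[(m %% k)%N]muln1; apply: (le_trans (H (m %% k)%N _ _ f1)).
by rewrite lee_fin ler_wpM2r// ler_nat ltnW// ltn_mod.
Qed.

Lemma sum_natSr n : \sum_(m < n) m.+1%:R = n%:R * (n%:R + 1) / 2 :> R.
Proof.
elim: n => [|n IH]; first by rewrite big_ord0 !mul0r.
by rewrite big_ord_recr/= IH -natr1; field.
Qed.

End Subadditive.

(** * The limit of the linearly weighted average *)

Section HalfLimit.
Context {d : measure_display} {W : measurableType d} {R : realType}.
Variables (P : probability W R) (p : nat).
Variable x : nat -> 'I_p -> {RV P >-> R}.
Variables n t : nat -> nat.
Variables Lambda Lambda_bar : 'M[R]_p.
Hypothesis a : cond_a x.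
Hypothesis n_lt_t : \forall T \near \oo, (n T < t T)%N.
Hypothesis n_cvgy : (n T)%:R @[T --> \oo] --> (+oo : set_system R).
Hypothesis limL : mx_lim P (fun T w => Lambda_hat x (n T) (t T) w) Lambda.
Hypothesis limLb :
  mx_lim P (fun T w => Lambda_bar_hat x (n T) (t T) w) Lambda_bar.

Lemma moment1_sum_le (I : Type) (s : seq I) (f : I -> W -> R) :
  (forall i, measurable_fun setT (f i)) ->
  (moment P 1 (fun w => (\sum_(i <- s) f i w)%R) <=
   \sum_(i <- s) moment P 1 (f i))%E.
Proof.
move=> mf; elim: s => [|i s IH].
  under eq_fun do rewrite big_nil.
  by rewrite big_nil (moment_cst P 1 0) normr0.
under eq_fun do rewrite big_cons.
rewrite big_cons; apply: le_trans (leeD (lexx _) IH).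
have := @moment_le_lin _ _ _ P (fun w => f i w + \sum_(i <- s) f i w) (f i)
  (fun w => \sum_(i <- s) f i w) 1 1 1 1 1.
rewrite !mul1e; apply => //.
- by apply: measurable_funD => //; exact: measurable_sum.
- exact: measurable_sum.
- by move=> w; rewrite !mul1r !expr1; exact: ler_normD.
Qed.

Lemma near_gt0_n : \forall T \near \oo, (0 < n T)%N.
Proof.
have /cvgryPgt/(_ 0) := n_cvgy.
by apply: filterS => T; rewrite ltr0n.
Qed.

(* Convergence in mean of the averages along the lengths n T forces it along
   all lengths, by subadditivity; and Lambda_bar_hat is an average of partial
   averages of x_i x_i' over the window. *)
Lemma Lambda_bar_half : Lambda_bar = 2^-1 *: Lambda.
Proof.
apply/matrixP => i j; rewrite mxE.
(* Its mean absolute value depends, by stationarity, on the length m only; this is the subadditive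
   sequence [f]. *)
pose dev m (V : nat -> 'cV[R]_p) := psum (outer V) m i j - m%:R * Lambda i j.
pose f m := moment P 1 (fun w => dev m (window x 1 w)).
have mdev m s : measurable_fun setT (fun w => dev m (window x s w)).
  apply: measurable_funD => //.
  by apply: (mx_measurable_psum (V := window x s)) => l; exact: mx_measurable_vec.
have fE m s : (0 < s)%N -> moment P 1 (fun w => dev m (window x s w)) = f m.
  move=> s0; apply: (stationary_moment_eq a 1 (F := dev m) s0 (ltn0Sn 0)).
  apply: measurable_funD => //.
  by apply: (mx_measurable_psum (V := path_window 0)) => l;
     exact: mx_measurable_path_window.
have dev0 V : dev 0%N V = 0 by rewrite /dev /psum big_ord0 mxE mul0r subr0.
have f0 : f 0%N = 0%E.
  rewrite /f; under eq_fun do rewrite dev0.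
  by rewrite (moment_cst P 1 0) normr0.
have fsub m l : (f (m + l)%N <= f m + f l)%E.
  rewrite -(fE l (1 + m)%N)//.
  have := @moment_le_lin _ _ _ P _ _ _ 1 1 1 1 1 (mdev (m + l)%N 1%N)
    (mdev m 1%N) (mdev l (1 + m)%N).
  rewrite !mul1e; apply => // w; rewrite !mul1r !expr1.
  rewrite (_ : dev (m + l)%N _ = dev m (window x 1 w) +
    dev l (window x (1 + m) w)); first exact: ler_normD.
  rewrite /dev /psum big_split_ord/= natrD mulrDl mxE opprD addrACA.
  congr (_ + (_ i j + _)); apply: eq_bigr => k _.
have [C C0 f1] : exists2 C, 0 <= C & (f 1%N <= C%:E)%E.
  have [_ Lx _] := a.
  have /Lfun1_integrable xx1 := Lfun2_mul_Lfun1 (Lx i) (Lx j).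
  have [e xe] := has_mean_integrable xx1.
  have [iD _] := has_meanD xe (has_mean_cst P (- Lambda i j)).
  have fin : (f 1%N < +oo)%E.
    have /integrableP[_] := iD.
    rewrite (_ : (\int[P]_w _)%E = f 1%N)//.
    apply: eq_integral => w _; rewrite /= expr1 /dev /psum big_ord1 mul1r.
    by rewrite outerE !mxE addn0.
  exists (fine (f 1%N)); first by rewrite fine_ge0// moment_ge0.
  by rewrite fineK// ge0_fin_numE// moment_ge0.
have fn (e : R) : 0 < e -> \forall T \near \oo, (f (n T) <= ((n T)%:R * e)%:E)%E.
  move=> e0; have [mL /(_ 0%N e e0) vL] := limL i j; near=> T.
  have nT : (n T < t T)%N by near: T.
  have n0 : (0 < n T)%N by near: T; exact: near_gt0_n.
  rewrite -(fE _ (t T - n T)%N) ?subn_gt0//.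
  have h : (moment P 1 (fun w => (Lambda_hat x (n T) (t T) w i j - Lambda i j)%R)
     <= e%:E)%E by near: T.
  have := @moment_le_lin _ _ _ P _ _ _ 1 1 1 (n T)%:R 0
    (mdev (n T) (t T - n T)%N) (mL T) (mL T).
  rewrite mul0e adde0 => h'; apply: (le_trans (h' _ _ _)) => //.
    move=> w; rewrite !expr1 mul0r addr0 Lambda_hatE// /dev mxE.
    rewrite -[(n T)%:R in leRHS]ger0_norm// -normrM mulrBr mulrA.
    rewrite [`|(n T)%:R|]ger0_norm// divff ?mul1r//.
    by rewrite pnatr_eq0 -lt0n.
  by rewrite EFinM; apply: lee_wpmul2l; rewrite ?lee_fin.
(* The weight of Lambda in [Lbar] if each partial sum of length k were k Lambda; it tends to 1/2. *)
pose c m : R := m%:R^-1 ^+ 2 * \sum_(k < m) k.+1%:R.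
have cE m : (0 < m)%N -> c m = 2^-1 + 2^-1 * m%:R^-1.
  by move=> m0; rewrite /c sum_natSr; field; rewrite pnatr_eq0 -lt0n.
have cvgV : (n T)%:R^-1 @[T --> \oo] --> (0 : R).
  apply/(gtr0_cvgV0 (f := fun T => (n T)%:R : R)) => //.
  by apply: filterS near_gt0_n => T; rewrite ltr0n.
have lim1 : c (n T) * Lambda i j @[T --> \oo] --> 2^-1 * Lambda i j.
  apply: cvgM; last exact: cvg_cst.
  have H : 2^-1 + 2^-1 * (n T)%:R^-1 @[T --> \oo] --> (2^-1 : R).
    suff : 2^-1 + 2^-1 * (n T)%:R^-1 @[T --> \oo] --> (2^-1 + 2^-1 * 0 : R).
      by rewrite mulr0 addr0.
    by apply: cvgD; [exact: cvg_cst|apply: cvgM => //; exact: cvg_cst].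
  move: H; apply: cvg_trans; apply: near_eq_cvg.
  by apply: filterS near_gt0_n => T nT; rewrite cE.
suff lim2 : c (n T) * Lambda i j @[T --> \oo] --> Lambda_bar i j.
  exact: (cvg_unique _ lim2 lim1).
apply/cvgrPdist_le => e e0; pose e3 := e / 3.
have e30 : 0 < e3 by rewrite divr_gt0.
(* A single good length among the n T controls all lengths. *)
have [k [k0 fk]] : exists k, (0 < k)%N /\ (f k <= (k%:R * e3)%:E)%E.
  have [T [h1 h2]] := filter_ex (filterI near_gt0_n (fn _ e30)).
  by exists (n T).
have fm := subadditive_linear_bound fsub f0 (ltW e30) C0 k0 fk f1.
have [mLb /(_ 0%N e3 e30) vLb] := limLb i j.
near=> T.
have nT : (n T < t T)%N by near: T.
have n0 : (0 < n T)%N by near: T; exact: near_gt0_n.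
have n0' : 0 < (n T)%:R :> R by rewrite ltr0n.
have h1 : (moment P 1 (fun w => (Lambda_bar_hat x (n T) (t T) w i j -
  Lambda_bar i j)%R) <= e3%:E)%E by near: T.
pose s := (t T - n T)%N; have s0 : (0 < s)%N by rewrite subn_gt0.
have mS : measurable_fun setT
    (fun w => \sum_(m < n T) dev m.+1 (window x s w)).
  by apply: measurable_sum => m; exact: mdev.
have h2 : (moment P 1 (fun w => (\sum_(m < n T) dev m.+1 (window x s w))%R) <=
    ((n T)%:R * ((n T)%:R * e3 + k%:R * C))%:E)%E.
  apply: (le_trans (moment1_sum_le _ (fun m : 'I_(n T) => mdev m.+1 s))).
  apply: (@le_trans _ _ (\sum_(m < n T) ((n T)%:R * e3 + k%:R * C)%:E)%E).
    apply: lee_sum => m _; rewrite fE//; apply: (le_trans (fm _)).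
    by rewrite lee_fin lerD2r ler_wpM2r ?ler_nat// ltW.
  by rewrite sumEFin lee_fin sumr_const card_ord -[leLHS]mulr_natl.
(* A constant is its own mean; this one splits into the averaged deviations of partial sums and the
   deviation of [Lambda_bar_hat]. *)
have h3 := @moment_le_lin _ _ _ P (fun _ => Lambda_bar i j - c (n T) * Lambda i j)
  _ _ 1 1 1 ((n T)%:R^-1 ^+ 2) 1 (measurable_cst _) mS (mLb T).
have : (`|Lambda_bar i j - c (n T) * Lambda i j|%:E <=
   ((n T)%:R^-1 ^+ 2)%:E * ((n T)%:R * ((n T)%:R * e3 + k%:R * C))%:E +
   1%:E * e3%:E)%E.
  rewrite -[`|_|]expr1 -(moment_cst P 1).
  apply: (le_trans (h3 _ _ _)) => //.
    move=> w; rewrite !expr1 mul1r Lambda_bar_hatE// LbarE mxE -/s.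
    set S := \sum_(m < n T) _.
    have <- : `|(n T)%:R^-1 ^+ 2 * S| = (n T)%:R^-1 ^+ 2 * `|S|.
      by rewrite normrM ger0_norm ?exprn_ge0 ?invr_ge0.
    have SE : S = ppsum (outer (window x s w)) (n T) i j -
        (\sum_(m < n T) m.+1%:R) * Lambda i j.
      by rewrite /S /dev sumrB /ppsum summxE mulr_suml.
    rewrite (_ : _ - _ * Lambda i j = (n T)%:R^-1 ^+ 2 * S -
      ((n T)%:R^-1 ^+ 2 * ppsum (outer (window x s w)) (n T) i j -
       Lambda_bar i j)); first exact: ler_normB.
    by rewrite SE /c; ring.
  by apply: leeD; apply: lee_wpmul2l => //; rewrite lee_fin.
rewrite -!EFinM -EFinD lee_fin mul1r => h; apply: (le_trans h).
have h4 : (n T)%:R^-1 * (k%:R * C) <= e3.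
  near: T; have : (n T)%:R^-1 * (k%:R * C) @[T --> \oo] --> (0 : R).
    by rewrite -[X in _ --> X](mul0r (k%:R * C)); apply: cvgM => //; exact: cvg_cst.
  move=> /cvgr0Pnorm_le/(_ e3 e30); apply: filterS => T.
  by apply: le_trans; exact: ler_norm.
rewrite (_ : _ ^+ 2 * _ = e3 + (n T)%:R^-1 * (k%:R * C)); last first.
  by field; rewrite gt_eqF.
by rewrite /e3 in h4 *; lra.
Unshelve. all: by end_near. Qed.

End HalfLimit.

(** * Positive definite matrices *)

Section PositiveDefinite.
Context {R : realType} {p : nat}.
Implicit Types A B M : 'M[R]_p.

Lemma posdef_unit M : posdef M -> M \in unitmx.
Proof.
move=> [_ pM]; rewrite unitmxE unitfE; apply/det0P => -[v v0 vM].
have vT0 : v^T != 0 by apply: contra v0 => /eqP h; rewrite -[v]trmxK h trmx0.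
by have := pM _ vT0; rewrite trmxK vM mul0mx mxE ltxx.
Qed.

(** Each diagonal entry is the quadratic form of [M] at a column of [B], nonzero as [B] is
    invertible; p > 0 provides at least one. *)
Lemma posdef_trace_gt0 M B : (0 < p)%N -> posdef M -> B \in unitmx ->
  0 < \tr (B^T *m M *m B).
Proof.
move=> p0 [_ pM] uB.
have E i : (B^T *m M *m B) i i = ((col i B)^T *m M *m col i B) 0 0.
  have -> : (col i B)^T *m M *m col i B =
      delta_mx 0 i *m (B^T *m M *m B) *m delta_mx i (0 : 'I_1).
    by rewrite colE trmx_mul trmx_delta !mulmxA.
  by rewrite -rowE -colE [RHS]mxE [RHS]mxE.
have h i : 0 < (B^T *m M *m B) i i.
  rewrite E; apply: pM; apply/eqP => c0.
  have : delta_mx i (0 : 'I_1) = 0 :> 'cV[R]_p.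
    by rewrite -[LHS](mulKmx uB) -colE c0 mulmx0.
  by move/matrixP/(_ i 0); rewrite !mxE !eqxx => /eqP; rewrite oner_eq0.
rewrite /mxtrace (bigD1 (Ordinal p0))//= ltr_pwDl//.
by apply: sumr_ge0 => i _; exact: ltW.
Qed.

End PositiveDefinite.

(** * Limits of the two terms of the mean squared error *)

Section Limits.
Context {d : measure_display} {W : measurableType d} {R : realType}.
Variables (P : probability W R) (p : nat).
Variables (x u : nat -> 'I_p -> {RV P >-> R}) (eps : nat -> {RV P >-> R}).
Variables (sigma_eps sigma_u : R) (n t : nat -> nat).
Variables Omega Lambda Lambda_bar Xi : 'M[R]_p.
Hypothesis a : cond_a x.
Hypothesis b : cond_b x u eps sigma_eps sigma_u.
Hypothesis c : cond_c x n t Omega Lambda Lambda_bar Xi.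
Hypothesis d' : cond_d x n t.
Hypothesis n_lt_t : \forall T \near \oo, (n T < t T)%N.
Hypothesis n_cvgy : (n T)%:R @[T --> \oo] --> (+oo : set_system R).

Let n_gt0 := near_gt0_n n_cvgy.

Definition inv_Omega_hat T w := invmx (Omega_hat x (n T) (t T) w).

Definition bias_trace T w : R :=
  \tr (inv_Omega_hat T w *m (Glow (n T) (window x (t T - n T) w) +
    Gup (n T) (window x (t T).+1 w)) *m inv_Omega_hat T w).

Lemma window_shift T w : (n T < t T)%N ->
  (fun i => window x (t T - n T) w ((n T).+1 + i)%N) = window x (t T).+1 w.
Proof.
by move=> nt; apply/funext => i; rewrite /window; congr (vec _ _ _); lia.
Qed.

Lemma MSE_traces T : (0 < T)%N -> (0 < n T)%N -> (n T < t T)%N ->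
  {ae P, forall w, window_sum x (n T) (t T) w \in unitmx} ->
  MSE x u eps T (n T) (t T) = (\int[P]_w
    (sigma_u ^+ 2 * ((n T)%:R / T%:R) / 4 * bias_trace T w +
     sigma_eps ^+ 2 / (2 * (n T)%:R) * \tr (inv_Omega_hat T w))%:E)%E.
Proof.
move=> T0 n0 nt uS; rewrite (MSE_conditional b)//.
have mOi : mx_measurable (inv_Omega_hat T).
  exact/mx_measurable_invmx/mx_measurable_Omega_hat.
apply: ae_eq_integral => //.
- apply/measurable_EFinP; apply: measurable_sum => e.
  apply: measurable_sum => k; apply: measurable_sum => o.
  apply: measurable_funM => //; apply: measurable_funX.
  by apply: (mx_measurable_error_coef (V := window x (t T - n T))) => i;
    exact: mx_measurable_vec.
- apply/measurable_EFinP; apply: measurable_funD; apply: measurable_funM => //.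
    apply: measurable_trace; apply: mx_measurableM => //.
    apply: mx_measurableM => //; apply: mx_measurableD;
      apply: mx_measurableZ => //.
      by apply: (mx_measurable_lower (V := window x (t T - n T))) => i;
        exact: mx_measurable_vec.
    by apply: (mx_measurable_upper (V := window x (t T).+1)) => i;
      exact: mx_measurable_vec.
  exact: measurable_trace.
apply: filterS uS => w uw _; congr (_%:E).
set V := window x (t T - n T) w; set N := (n T + n T).+1.
have SE : window_sum x (n T) (t T) w = psum (outer V) N by exact: window_sumE.
have uS : psum (outer V) N \in unitmx by rewrite -SE.
have := error_coef_energy (Num.sqrt T%:R)^-1 (sigma_eps ^+ 2) (sigma_u ^+ 2) uS.
move=> /= ->.
have nz : (n T)%:R != 0 :> R by rewrite pnatr_eq0 -lt0n.
have Tz : T%:R != 0 :> R by rewrite pnatr_eq0 -lt0n.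
(* Source of the constants: two inverses give (2n)^-2, which with n^3 from the Gram sums and 1/T
   leaves (n / T) / 4; the single inverse gives 1 / (2n). *)
have invE : inv_Omega_hat T w = (2 * (n T)%:R) *: invmx (psum (outer V) N).
  rewrite /inv_Omega_hat /Omega_hat SE invmxZ ?invrK//.
  by rewrite unitmxZ// unitfE invr_eq0 mulf_neq0 ?nz// pnatr_eq0.
rewrite /bias_trace invE /Glow /Gup -scalerDr -(window_shift w nt) -/V.
have kE : (Num.sqrt T%:R)^-1 ^+ 2 = T%:R^-1 :> R by rewrite exprVn sqr_sqrtr.
rewrite -!scalemxAl -!scalemxAr -!scalemxAl !linearZ/= kE -/N.
set X := \tr (_ *m _ *m _); set Y := \tr _.
by field; rewrite nz Tz.
Qed.

Let limL : mx_lim P (fun T w => Lambda_hat x (n T) (t T) w) Lambda.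
Proof.
have [_ _ _ cL _] := c; apply: mx_lim_in_probability => //.
exact: mx_bounded_Lambda_hat.
Qed.

Let limLb : mx_lim P (fun T w => Lambda_bar_hat x (n T) (t T) w) Lambda_bar.
Proof.
have [_ _ _ _ [cL _]] := c; apply: mx_lim_in_probability => //.
exact: (mx_bounded_Lambda_bar_hat a d').
Qed.

Let limXi : mx_lim P (fun T w => Xi_hat x (n T) (t T) w) Xi.
Proof.
have [_ _ _ _ [_ cX]] := c; apply: mx_lim_in_probability => //.
exact: (mx_bounded_Xi_hat a d').
Qed.

Let halfL : Lambda_bar = 2^-1 *: Lambda := Lambda_bar_half a n_lt_t n_cvgy limL limLb.

Lemma mx_measurable_Glow m s : mx_measurable (fun w => Glow m (window x s w)).
Proof.
apply: mx_measurableZ => //.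
by apply: (mx_measurable_lower (V := window x s)) => i; exact: mx_measurable_vec.
Qed.

Lemma mx_measurable_Gup m s : mx_measurable (fun w => Gup m (window x s w)).
Proof.
apply: mx_measurableZ => //.
by apply: (mx_measurable_upper (V := window x s)) => i; exact: mx_measurable_vec.
Qed.

Lemma mx_lim_Glow : mx_lim P
  (fun T w => Glow (n T) (window x (t T - n T) w)) (Lambda *m Lambda_bar - Xi).
Proof.
apply: (mx_lim_near_eq _ (mx_limB (mx_limM limL limLb) limXi)).
  by move=> T; exact: mx_measurable_Glow.
apply: filterS n_lt_t => T nt w.
by rewrite GlowE Lambda_hatE// Lambda_bar_hatE// Xi_hatE.
Qed.

Lemma mx_lim_Gup_left : mx_lim P
  (fun T w => Gup (n T) (window x (t T - n T) w)) (Lambda *m Lambda_bar - Xi).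
Proof.
have cvg1 : 1 + (n T)%:R^-1 @[T --> \oo] --> (1 : R).
  suff : 1 + (n T)%:R^-1 @[T --> \oo] --> (1 + 0 : R) by rewrite addr0.
  apply: cvgD; first exact: cvg_cst.
  apply/(gtr0_cvgV0 (f := fun T => (n T)%:R : R)) => //.
  by apply: filterS n_gt0 => T; rewrite ltr0n.
(* As Lambda_bar = Lambda / 2, the first three terms on the right cancel. *)
have -> : Lambda *m Lambda_bar - Xi = 1 *: (Lambda *m Lambda) -
    Lambda *m Lambda_bar - Lambda_bar *m Lambda + (Lambda *m Lambda_bar - Xi).
  rewrite halfL -!scalemxAl -!scalemxAr.
  by apply/matrixP => i j; rewrite !mxE; field.
apply: (mx_lim_near_eq _ (mx_limD (mx_limB (mx_limB
  (mx_limZ cvg1 (mx_limM limL limL)) (mx_limM limL limLb))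
  (mx_limM limLb limL)) mx_lim_Glow)).
  by move=> T; exact: mx_measurable_Gup.
apply: filterS (filterI n_lt_t n_gt0) => T [nt n0] w.
by rewrite GupE// Lambda_hatE// Lambda_bar_hatE.
Qed.

(* The window to the right of t has the same law as the one to its left. *)
Lemma mx_lim_Gup : mx_lim P
  (fun T w => Gup (n T) (window x (t T).+1 w)) (Lambda *m Lambda_bar - Xi).
Proof.
move=> i j; apply: (moments_vanish_near_moment _ (mx_lim_Gup_left i j)).
  by move=> T; apply: measurable_funD => //; exact: mx_measurable_Gup.
apply: filterS n_lt_t => T nt k.
set L := _ - Xi.
pose F (V : nat -> 'cV[R]_p) := Gup (n T) V i j - L i j.
have mF : measurable_fun setT
    (fun f : @pathspace R (nat * 'I_p) => F (path_window 0 f)).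
  apply: measurable_funD => //; apply: mx_measurableZ => //.
  by apply: (mx_measurable_upper (V := path_window 0)) => l;
     exact: mx_measurable_path_window.
have s0 : (0 < t T - n T)%N by rewrite subn_gt0.
exact: (stationary_moment_eq a k s0 (ltn0Sn (t T)) mF).
Qed.

Lemma mx_lim_inv_Omega_hat : mx_lim P inv_Omega_hat (invmx Omega).
Proof.
have [pO _ cO _ _] := c; have [uS _] := d'.
apply: mx_lim_invmx; first exact: posdef_unit.
- apply: mx_lim_in_probability => //.
  exact: (mx_bounded_Omega_hat a d').
- exact: (mx_bounded_inv_Omega_hat d').
apply: filterS (filterI uS n_gt0) => T [uST n0]; apply: filterS uST => w uw.
by rewrite /Omega_hat unitmxZ// unitfE invr_eq0 mulf_neq0 ?pnatr_eq0// -lt0n.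
Qed.

Lemma bias_trace_vanish : moments_vanish P (fun T w => bias_trace T w -
  \tr (invmx Omega *m
    (Lambda *m Lambda_bar + Lambda_bar *m Lambda - 2 *: Xi) *m invmx Omega)).
Proof.
apply: moments_vanish_trace; apply: mx_limM mx_lim_inv_Omega_hat.
apply: (mx_limM mx_lim_inv_Omega_hat).
(* Lambda and Lambda_bar commute, one being half the other. *)
have -> : Lambda *m Lambda_bar + Lambda_bar *m Lambda - 2 *: Xi =
    (Lambda *m Lambda_bar - Xi) + (Lambda *m Lambda_bar - Xi).
  rewrite halfL -!scalemxAl -!scalemxAr.
  by apply/matrixP => i j; rewrite !mxE; ring.
by apply: mx_limD; [exact: mx_lim_Glow|exact: mx_lim_Gup].
Qed.

Lemma noise_trace_vanish :
  moments_vanish P (fun T w => \tr (inv_Omega_hat T w) - \tr (invmx Omega)).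
Proof. exact: moments_vanish_trace mx_lim_inv_Omega_hat. Qed.

Lemma MSE_expectations : \forall T \near \oo, MSE x u eps T (n T) (t T) =
  (sigma_u ^+ 2 * ((n T)%:R / T%:R) / 4 *
     fine (\int[P]_w (bias_trace T w)%:E)%E +
   sigma_eps ^+ 2 / (2 * (n T)%:R) *
     fine (\int[P]_w (\tr (inv_Omega_hat T w))%:E)%E)%:E.
Proof.
have [uS _] := d'; near=> T.
rewrite MSE_traces; [|by near: T; exists 1%N|by near: T; exact: n_gt0
  |by near: T|by near: T].
have mean (X : nat -> W -> R) : P.-integrable setT (EFin \o X T) ->
    has_mean P (X T) (fine (\int[P]_w (X T w)%:E)%E).
  move=> iX; split => //.
  by rewrite fineK//; exact: (integrable_fin_num measurableT iX).
have h1 : P.-integrable setT (EFin \o bias_trace T).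
  near: T; apply: moments_bounded_integrable.
  exact: moments_vanish_sub_bounded bias_trace_vanish.
have h2 : P.-integrable setT (EFin \o (fun w => \tr (inv_Omega_hat T w))).
  near: T; apply: (moments_bounded_integrable
    (X := fun T w => \tr (inv_Omega_hat T w))).
  exact: moments_vanish_sub_bounded noise_trace_vanish.
exact: (has_meanD (has_meanZ _ (mean _ h1))
  (has_meanZ _ (mean (fun T w => \tr (inv_Omega_hat T w)) h2))).2.
Unshelve. all: by end_near. Qed.

End Limits.

(** * Relative errors and the final expansion *)

Lemma trace_dim0 {R : realType} (p : nat) (A : 'M[R]_p) : (p == 0)%N -> \tr A = 0.
Proof. by move/eqP => p0; move: A; rewrite p0 => A; rewrite /mxtrace big_ord0. Qed.

Theorem propositionB1 (d : measure_display) (W : measurableType d)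
    (R : realType) (P : probability W R) (p : nat)
    (x u : nat -> 'I_p -> {RV P >-> R}) (eps : nat -> {RV P >-> R})
    (sigma_eps sigma_u : R)
    (h : nat -> R) (n t : nat -> nat)
    (Omega Lambda Lambda_bar Xi : 'M[R]_p)
    (Th_integer : forall T : nat, T%:R * h T = (n T)%:R)
    (h_cvg0 : h T @[T --> \oo] --> 0)
    (Th_cvgy : T%:R * h T @[T --> \oo] --> +oo)
    (t_interior : \forall T \near \oo,
       (n T < t T)%N /\ (t T + n T <= T)%N)
    (a : cond_a x)
    (b : cond_b x u eps sigma_eps sigma_u)
    (c : cond_c x n t Omega Lambda Lambda_bar Xi)
    (d' : cond_d x n t) :
  exists r1 r2 : nat -> R,
    [/\ r1 T @[T --> \oo] --> 0,
        r2 T @[T --> \oo] --> 0 &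
        \forall T \near \oo,
          MSE x u eps T (n T) (t T) =
          (sigma_u ^+ 2 * h T / 4 *
             \tr (invmx Omega *m
                  (Lambda *m Lambda_bar + Lambda_bar *m Lambda - 2 *: Xi) *m
                  invmx Omega) * (1 + r1 T) +
           sigma_eps ^+ 2 / (2 * (T%:R * h T)) *
             \tr (invmx Omega) * (1 + r2 T))%:E].
Proof.
have n_lt_t : \forall T \near \oo, (n T < t T)%N.
  by apply: filterS t_interior => T [].
have n_cvgy : (n T)%:R @[T --> \oo] --> (+oo : set_system R).
  by under eq_fun do rewrite -Th_integer.
have MSE_E := MSE_expectations a b c d' n_lt_t n_cvgy.
set Q := \tr (_ *m _ *m _); set r := \tr (invmx Omega).
pose q T : R := fine (\int[P]_w (bias_trace x n t T w)%:E)%E.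
pose s T : R := fine (\int[P]_w (\tr (inv_Omega_hat x n t T w))%:E)%E.
have qQ : q T @[T --> \oo] --> Q.
  apply: expectation_cvg_of_vanish.
  exact: bias_trace_vanish.
have sr : s T @[T --> \oo] --> r.
  apply: (expectation_cvg_of_vanish (X := fun T w => \tr (inv_Omega_hat x n t T w))).
  exact: (noise_trace_vanish a c).
(* The relative error f / l - 1 requires a nonzero limit, which positive definiteness gives for p >
   0; for p = 0 both sides are zero and so is the error chosen. *)
have rel (f : nat -> R) l : f T @[T --> \oo] --> l ->
    ((p == 0)%N -> forall T, f T = 0) -> ((p == 0)%N -> l = 0) ->
    ((0 < p)%N -> l != 0) ->
    exists2 g : nat -> R, g T @[T --> \oo] --> 0 & forall T, f T = l * (1 + g T).
  move=> fl f0 l0 lp; have [p0|p0] := boolP (p == 0)%N.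
    exists (fun=> 0); first exact: cvg_cst.
    by move=> T; rewrite f0// l0// mul0r.
  have ln : l != 0 by apply: lp; rewrite lt0n.
  exists (fun T => f T / l - 1); last by move=> T; field.
  have -> : 0 = l / l - 1 by rewrite divff// subrr.
  by apply: cvgB; [apply: cvgM => //; exact: cvg_cst|exact: cvg_cst].
have [pO pM _ _ _] := c.
have uO := posdef_unit pO.
have sO : (invmx Omega)^T = invmx Omega by rewrite trmx_inv pO.1.
have uOi : invmx Omega \in unitmx by rewrite unitmx_inv.
have [r1 r10 r1E] : exists2 g : nat -> R, g T @[T --> \oo] --> 0 &
    forall T, q T = Q * (1 + g T).
  apply: rel => //.
  - move=> p0 T; rewrite /q.
    by under eq_integral do rewrite /bias_trace trace_dim0//; rewrite integral0.
  - exact: trace_dim0.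
  - by move=> p0; have := posdef_trace_gt0 p0 pM uOi; rewrite sO => /gt_eqF ->.
have [r2 r20 r2E] : exists2 g : nat -> R, g T @[T --> \oo] --> 0 &
    forall T, s T = r * (1 + g T).
  apply: rel => //.
  - move=> p0 T; rewrite /s.
    by under eq_integral do rewrite trace_dim0//; rewrite integral0.
  - exact: trace_dim0.
  (* For M = Omega and B = Omega^-1 the matrix B' M B reduces to Omega^-1. *)
  - move=> p0; have := posdef_trace_gt0 p0 pO uOi.
    by rewrite sO mulVmx// mul1mx => /gt_eqF ->.
exists r1, r2; split => //.
have T_gt0 : \forall T \near \oo, (0 < T)%N by exists 1%N.
apply: filterS (filterI MSE_E T_gt0) => T [-> T0].
have Tz : T%:R != 0 :> R by rewrite pnatr_eq0 -lt0n.
have hE : h T = (n T)%:R / T%:R by rewrite -Th_integer mulrAC divff// mul1r.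
by rewrite -/(q T) -/(s T) r1E r2E Th_integer hE !mulrA.
Qed.
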